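(* Let $N\ge1$, $0<\lambda\le\Lambda$, assume $\beta=\frac{\Lambda}{\lambda}(N-1)+1>2$, and let $1\le q\le\frac{\beta}{\beta-2}$. Let $u,v\in C(\mathbb{R}^N)$ be, respectively, a viscosity subsolution and a viscosity supersolution of $$\mathcal{M}^+_{\lambda,\Lambda}(D^2z)-|z|^{q-1}z=0\quad\text{in }\mathbb{R}^N,$$ with $u\le v$ in $\mathbb{R}^N$. Then $u\equiv v$ in $\mathbb{R}^N$.
   Context: For $M\in\mathrm{Sym}_N$ with eigenvalues $e_1,\dots,e_N$, $\mathcal{M}^+_{\lambda,\Lambda}(M)=\sup_{\lambda I_N\le A\le\Lambda I_N}(-\mathrm{Tr}(AM))=-\lambda\sum_{e_k>0}e_k-\Lambda\sum_{e_k<0}e_k$. A continuous $v$ is a viscosity supersolution of $G(x,z,Dz,D^2z)=0$ if whenever $\varphi\in C^2$ and $v-\varphi$ has a local minimum at $x_0$, $G(x_0,v(x_0),D\varphi(x_0),D^2\varphi(x_0))\ge0$; a continuous $u$ is a viscosity subsolution if whenever $u-\varphi$ has a local maximum at $x_0$, $G(x_0,u(x_0),D\varphi(x_0),D^2\varphi(x_0))\le0$. *)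

(* Defs.v *)
From HB Require Import structures.
From mathcomp Require Import all_boot all_order all_algebra.
From mathcomp Require Import all_classical all_reals all_analysis.
Set Implicit Arguments. Unset Strict Implicit. Unset Printing Implicit Defensive.
Import Order.TTheory GRing.Theory Num.Theory.
Import numFieldNormedType.Exports.
Local Open Scope classical_set_scope.
Local Open Scope ring_scope.

Section Defs.
Variables (R : realType) (N : nat).

Definition basis_vec (i : 'I_N) : 'rV[R]_N := delta_mx 0 i.

Definition partial (f : 'rV[R]_N -> R) (i : 'I_N) : 'rV[R]_N -> R :=
  fun x => derive f x (basis_vec i).

Definition C2 (f : 'rV[R]_N -> R) : Prop :=
  continuous f /\
  forall i : 'I_N,
    (forall x, derivable f x (basis_vec i)) /\ continuous (partial f i) /\
    forall j : 'I_N,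
      (forall x, derivable (partial f i) x (basis_vec j)) /\
      continuous (partial (partial f i) j).

Definition hessian (f : 'rV[R]_N -> R) (x : 'rV[R]_N) : 'M[R]_N :=
  \matrix_(i, j) partial (partial f j) i x.

Definition ellipticity_set (lam Lam : R) : set 'M[R]_N :=
  [set A | A^T = A /\ forall xi : 'rV[R]_N,
     lam * (xi *m xi^T) 0 0 <= (xi *m A *m xi^T) 0 0 /\
     (xi *m A *m xi^T) 0 0 <= Lam * (xi *m xi^T) 0 0].

Definition pucci_max (lam Lam : R) (M : 'M[R]_N) : R :=
  sup [set - \tr (A *m M) | A in ellipticity_set lam Lam].

Definition absorption (q z : R) : R := (`|z| `^ (q - 1)) * z.

Definition visc_super (lam Lam q : R) (v : 'rV[R]_N -> R) : Prop :=
  continuous v /\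
  forall (phi : 'rV[R]_N -> R) (x0 : 'rV[R]_N), C2 phi ->
    (\forall x \near x0, v x0 - phi x0 <= v x - phi x) ->
    0 <= pucci_max lam Lam (hessian phi x0) - absorption q (v x0).

Definition visc_sub (lam Lam q : R) (u : 'rV[R]_N -> R) : Prop :=
  continuous u /\
  forall (phi : 'rV[R]_N -> R) (x0 : 'rV[R]_N), C2 phi ->
    (\forall x \near x0, u x - phi x <= u x0 - phi x0) ->
    pucci_max lam Lam (hessian phi x0) - absorption q (u x0) <= 0.

End Defs.

(* Main.v *)
(**
  Write [w = v - u >= 0]. The operator is a supremum of linear operators
  [M |-> - tr (A M)], so averaging preserves subsolutions: after Steklov averaging
  [u] becomes a C2 function [u_e] that is a classical subsolution up to an
  error tending to 0. Hence [phi + u_e] can be used as a test function for [v],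
  and subadditivity shows that [w] is a viscosity supersolution of
  [M^+(D^2 w) >= 2^-q w^q]. This replaces Ishii's theorem on sums.

  To see that averaging preserves a viscosity inequality
  [- tr (A D^2 u) <= F], one approximates [u] near a point by a trigonometric
  sum [p] that is bounded on the whole space, solves [h - tau tr (A D^2 h) = p]
  explicitly, and compares: [u <= h + tau F + O(tau^2)] near the point. The
  equation for [h] commutes with averaging, and [tau --> 0].

  It remains to prove the Liouville theorem for [w]. Put
  [ga = (beta - 2) / 2]. If [w] is positive at [y], comparison with radial
  functions of [s = |x - y|^2] gives first [w >= C s^-ga], then, since
  [q <= (ga + 1) / ga], the improvement [w >= k s^-ga ln s] for large [s]. But
  testing [w] with a concave paraboloid on the ball [s <= T] shows that the
  minimum [m] of [w] on it satisfies [m^(q-1) <= C / T], which contradicts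
  [m >= K T^-ga] for large [K] and [T].
*)
Require Import Defs.
From HB Require Import structures.
From mathcomp Require Import all_boot all_order all_algebra.
From mathcomp Require Import all_classical all_reals all_analysis.
From mathcomp Require Import ring lra.
Set Implicit Arguments. Unset Strict Implicit. Unset Printing Implicit Defensive.
Import Order.TTheory GRing.Theory Num.Theory.
Import numFieldNormedType.Exports.
Local Open Scope classical_set_scope.
Local Open Scope ring_scope.

(** * Directional derivatives and C2 functions *)

Section Calculus.
Variables (R : realType) (N : nat).
Local Notation V := 'rV[R]_N.
Implicit Types (f : V -> R) (x y v : V).

(** The number [beta] plays the role of a dimension. On a radial profile that decreases and is
    convex along rays, the extremal matrix has weight [lam] radially and [Lam] tangentially; in the
    variable [s] the operator becomes [-4 lam ((ga + 1) g' + s g'')] with [ga + 1 = beta / 2], and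
    [s^-ga] is its fundamental solution. The bound on [q] means [(q - 1) ga <= 1]. At equality the
    decay forced by the absorption has the same order as [s^-ga], so the power bound alone
    contradicts nothing; the logarithm breaks the tie. Trigonometric sums serve twice: a
    constant-coefficient operator acts on each mode by a scalar, so the resolvent is explicit, and
    boundedness on the whole space lets the maximum principle bound it uniformly in [tau], without
    boundary data. All errors must be [O(tau^2)], since the resulting inequality is divided by
    [tau]. [C2] speaks of partial derivatives only, so derivatives along arbitrary lines have to be
    recovered from the continuity of the partials. *)

Lemma is_derive_line f x v d :
  is_derive x v f d <-> is_derive (0 : R) 1 (fun t : R => f (x + t *: v)) d.
Proof.
have E : (fun h : R => h^-1 *: (f (h *: v + x) - f x)) =
  (fun h : R => h^-1 *: (f (x + (h *: (1 : R) + 0) *: v) - f (x + 0 *: v))).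
  by apply/funext => h; rewrite scale0r !addr0 [h *: 1]mulr1 [x + _]addrC.
split => -[dv dd]; split.
- by move: dv; rewrite /derivable E.
- by move: dd; rewrite /derive E.
- by move: dv; rewrite /derivable E.
- by move: dd; rewrite /derive E.
Qed.

Lemma is_derive_line_at f x v d (t : R) : is_derive (x + t *: v) v f d ->
  is_derive t 1 (fun t : R => f (x + t *: v)) d.
Proof.
have E : (fun h : R => h^-1 *: (f (h *: v + (x + t *: v)) - f (x + t *: v))) =
  (fun h : R => h^-1 *: (f (x + (h *: (1 : R) + t) *: v) - f (x + t *: v))).
  apply/funext => h; rewrite scalerDl [h *: 1]mulr1; do 2 f_equal.
  by rewrite addrCA.
move=> -[dv dd]; split.
- by move: dv; rewrite /derivable E.
- by move: dd; rewrite /derive E.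
Qed.

Lemma is_derive_comp1 (g : R -> R) f x v dg df :
  is_derive (f x) 1 g dg -> is_derive x v f df ->
  is_derive x v (g \o f) (dg * df).
Proof.
move=> Dg /is_derive_line Df; apply/is_derive_line.
apply: (@is_derive1_comp R g (fun t : R => f (x + t *: v)) 0) => //.
by rewrite scale0r addr0.
Qed.

Lemma is_derive_coord (j : 'I_N) x v :
  is_derive x v (fun y : V => y 0 j) (v 0 j).
Proof.
apply/is_derive_line.
have -> : (fun t : R => (x + t *: v) 0 j) = cst (x 0 j) + (v 0 j *: id).
  by apply/funext => t; rewrite !mxE /GRing.add /GRing.scale /= mulrC.
apply: is_derive_eq (is_deriveD (is_derive_cst _ _ _) (is_deriveZ (v 0 j)
  (is_derive_id _ _))) _.
by rewrite add0r [_ *: 1]mulr1.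
Qed.

Lemma is_deriveP (W : normedModType R) (f : W -> R) (x v : W) d : is_derive x v f d <->
  forall e : R, 0 < e -> exists2 r : R, 0 < r &
    forall t : R, t != 0 -> `|t| < r -> `|f (x + t *: v) - f x - t * d| <= e * `|t|.
Proof.
have Q (t : R) : t != 0 -> `|f (x + t *: v) - f x - t * d| =
    `|d - t^-1 *: (f (t *: v + x) - f x)| * `|t|.
  move=> t0; rewrite -normrM -normrN; congr (`|_|).
  by rewrite /GRing.scale /= mulrBl mulrAC mulVf // mul1r [x + _]addrC; ring.
split.
- move=> [dv dd] e e0.
  have : (h^-1 *: (f (h *: v + x) - f x)) @[h --> 0^'] --> d by rewrite -dd.
  move/cvgrPdist_le => /(_ e e0); rewrite near_withinE => -[r /= r0 H].
  exists r => // t t0 tr; rewrite Q //; apply: ler_wpM2r => //.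
  by apply: H => //=; rewrite sub0r normrN.
- move=> H.
  have C : (h^-1 *: (f (h *: v + x) - f x)) @[h --> 0^'] --> d.
    apply/cvgrPdist_le => e e0; have [r r0 Hr] := H e e0.
    rewrite near_withinE; exists r => //= t; rewrite /= sub0r normrN => tr t0.
    by have := Hr t t0 tr; rewrite Q // ler_pM2r // normr_gt0.
  split; first by apply/cvg_ex; exists d.
  exact: cvg_lim C.
Qed.

Lemma is_derive_sumf (I : Type) (r : seq I) (f : I -> V -> R) (d : I -> R) x v :
  (forall i, is_derive x v (f i) (d i)) ->
  is_derive x v (fun y => \sum_(i <- r) f i y) (\sum_(i <- r) d i).
Proof.
move=> H; elim: r => [|i r IH].
  have -> : (fun y => \sum_(i <- [::]) f i y) = cst 0.
    by apply/funext => y; rewrite big_nil.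
  rewrite big_nil; exact: is_derive_cst.
have -> : (fun y => \sum_(i <- i :: r) f i y) =
    f i + (fun y => \sum_(i <- r) f i y).
  by apply/funext => y; rewrite big_cons.
by rewrite big_cons; apply: is_deriveD.
Qed.

Lemma continuous_sumf (T : topologicalType) (I : Type) (r : seq I)
    (f : I -> T -> R) :
  (forall i, continuous (f i)) -> continuous (fun t : T => \sum_(i <- r) f i t).
Proof.
move=> H; elim: r => [|i r IH] t.
  have -> : (fun t : T => \sum_(i <- [::]) f i t) = cst 0.
    by apply/funext => s; rewrite big_nil.
  exact: cvg_cst.
have -> : (fun t : T => \sum_(i <- i :: r) f i t) =
    (fun t => f i t + \sum_(i <- r) f i t).
  by apply/funext => s; rewrite big_cons.
by apply: cvgD; [exact: H | exact: IH].
Qed.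

Lemma near_rVP x (P : set V) : (\forall y \near x, P y) <->
  exists2 r : R, 0 < r & forall y, `|y - x| < r -> P y.
Proof.
split.
- move=> /nbhs_ballP[r /= r0 H]; exists r => // y yx; apply: H.
  by rewrite mx_norm_ball /ball_ /= distrC.
- move=> [r r0 H]; apply/nbhs_ballP; exists r => //= y.
  by rewrite mx_norm_ball /ball_ /= distrC; exact: H.
Qed.

Lemma continuousPnorm (f : V -> R) : continuous f <->
  forall x (e : R), 0 < e -> exists2 r : R, 0 < r &
    forall y, `|y - x| < r -> `|f y - f x| < e.
Proof.
split.
- move=> cf x e e0; have /(@cvgrPdist_lt _ _ _ _ (nbhs_filter x))/(_ e e0)/near_rVP[r
    r0 H] := cf x.
  by exists r => // y /H; rewrite distrC.
- move=> H x; apply/(@cvgrPdist_lt _ _ _ _ (nbhs_filter x)) => e e0; apply/near_rVP.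
  have [r r0 Hr] := H x e e0; exists r => // y /Hr.
  by rewrite distrC.
Qed.

Lemma continuous_line x v : continuous (fun t : R => x + t *: v).
Proof.
by move=> t; apply: cvgD; [exact: cvg_cst | apply: cvgZr_tmp; exact: cvg_id].
Qed.

Definition has_grad f (g : 'I_N -> V -> R) :=
  forall i x, is_derive x (basis_vec R i) f (g i x).

(* Mean value theorem in the direction [e_i] only: no total differentiability
   of [f] is assumed. *)
Lemma is_derive_add_basis f (g : V -> R) (i : 'I_N) x v d (a : R) :
  (forall y, is_derive y (basis_vec R i) f (g y)) -> continuous g ->
  is_derive x v f d ->
  is_derive x (v + a *: basis_vec R i) f (d + a * g x).
Proof.
move=> Df cg /is_deriveP Dv; apply/is_deriveP => e e0.
set ei := basis_vec R i.
have [r1 r10 H1] := Dv (e / 2) (divr_gt0 e0 (ltr0Sn _ 1)).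
pose e2 := e / 2 / (`|a| + 1).
have a1 : 0 < `|a| + 1 by rewrite ltr_wpDl.
have e20 : 0 < e2 by rewrite !divr_gt0.
have /continuousPnorm/(_ x e2 e20)[r2 r20 H2] := cg.
(* A point [t v + c ei] with |c| <= |t a| has norm at most |t| [M], hence stays within [r2]. *)
pose M := `|v| + `|a| * `|ei| + 1.
have M0 : 0 < M by rewrite /M ltr_wpDl // addr_ge0 // mulr_ge0.
exists (Num.min r1 (r2 / M)); first by rewrite lt_min r10 divr_gt0.
move=> t t0; rewrite lt_min => /andP[t1 t2].
pose k (s : R) := f (x + t *: v + s *: ei).
have Dk (s : R) : is_derive s 1 k (g (x + t *: v + s *: ei)).
  by apply: is_derive_line_at.
have [c cI kc] : exists2 c : R,
  `|c| <= `|t * a| & k (t * a) - k 0 = g (x + t *: v + c *: ei) * (t * a).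
  have ck : continuous k.
    by move=> s; apply/differentiable_continuous/derivable1_diffP; case: (Dk s).
  have [ta|ta] := leP 0 (t * a).
    have [c] := MVT_segment ta (fun s _ => Dk s) (continuous_subspaceT ck).
    rewrite in_itv /= subr0 => /andP[c0 c1] ->; exists c => //.
    by rewrite !ger0_norm.
  have [c] := MVT_segment (ltW ta) (fun s _ => Dk s) (continuous_subspaceT ck).
  rewrite in_itv /= sub0r => /andP[c0 c1] E; exists c.
    by rewrite !ler0_norm ?lerN2 // ltW.
  by rewrite -opprB E mulrN opprK.
have gc : `|g (x + t *: v + c *: ei) - g x| < e2.
  apply: H2.
  have -> : x + t *: v + c *: ei - x = t *: v + c *: ei
    by rewrite -[x + _ + _]addrA [x + _]addrC addrK.
  apply: le_lt_trans (ler_normD _ _) _; rewrite !normrZ.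
  move: t2; rewrite ltr_pdivlMr //; apply: le_lt_trans; rewrite /M !mulrDr mulr1.
  rewrite -addrA lerD2l mulrA -normrM.
  by apply: ler_wpDr => //; exact: ler_wpM2r.
have -> : f (x + t *: (v + a *: ei)) = k (t * a).
  by rewrite /k scalerDr scalerA addrA.
have -> : k (t * a) - f x - t * (d + a * g x) =
  (f (x + t *: v) - f x - t * d) + (g (x + t *: v + c *: ei) - g x) * (t * a).
  have : k 0 = f (x + t *: v) by rewrite /k scale0r addr0.
  move=> E; rewrite -E; move: kc => /eqP; rewrite subr_eq => /eqP ->; ring.
apply: le_trans (ler_normD _ _) _.
have -> : e * `|t| = e / 2 * `|t| + e / 2 * `|t|.
  by rewrite -mulrDl; congr (_ * _); field.
apply: lerD; first exact: H1.
rewrite !normrM mulrCA mulrC; apply: ler_wpM2r => //.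
have -> : e / 2 = e2 * (`|a| + 1) by rewrite /e2 divfK // gt_eqF.
by apply: ler_pM => //; [exact: ltW | rewrite lerDl].
Qed.

(** The direction is built from 0 one coordinate at a time, each coordinate costing one use of
    [is_derive_add_basis]. *)
Lemma is_derive_dir f g x v : has_grad f g -> (forall i, continuous (g i)) ->
  is_derive x v f (\sum_i v 0 i * g i x).
Proof.
move=> Df cg; rewrite [X in is_derive _ X](row_sum_delta v).
elim: (index_enum _) => [|i s IH].
  by rewrite !big_nil; exact: is_derive0.
rewrite !big_cons addrC [X in is_derive _ _ _ X]addrC.
by apply: is_derive_add_basis.
Qed.

Lemma partialE f g i : has_grad f g -> partial f i = g i.
Proof. by move=> H; apply/funext => x; rewrite /partial; case: (H i x). Qed.

Lemma C2I f g (h : 'I_N -> 'I_N -> V -> R) : continuous f ->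
  has_grad f g -> (forall i, continuous (g i)) ->
  (forall i, has_grad (g i) (h i)) -> (forall i j, continuous (h i j)) -> C2 f.
Proof.
move=> cf Df cg Dg ch; split=> // i; split; first by move=> x; case: (Df i x).
rewrite (partialE _ Df); split=> // j; split; first by move=> x; case: (Dg i j x).
by rewrite (partialE _ (Dg i)).
Qed.

Lemma hessianE f g (h : 'I_N -> 'I_N -> V -> R) x : has_grad f g ->
  (forall i, has_grad (g i) (h i)) -> hessian f x = \matrix_(i, j) h j i x.
Proof.
move=> Df Dg; apply/matrixP => i j; rewrite !mxE.
by rewrite (partialE _ Df) (partialE _ (Dg j)).
Qed.

Lemma C2_grad f : C2 f ->
  [/\ continuous f, has_grad f (fun i => partial f i),
   forall i, continuous (partial f i),
   forall i, has_grad (partial f i) (fun j => partial (partial f i) j) &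
   forall i j, continuous (partial (partial f i) j)].
Proof.
move=> [cf H]; split=> //.
- by move=> i x; have [d _] := H i; apply: derivableP.
- by move=> i; have [_ []] := H i.
- by move=> i j x; have [_ [_ /(_ j) [d _]]] := H i; apply: derivableP.
- by move=> i j; have [_ [_ /(_ j) []]] := H i.
Qed.

Lemma has_gradD f f' g g' : has_grad f g -> has_grad f' g' ->
  has_grad (fun x => f x + f' x) (fun i x => g i x + g' i x).
Proof. by move=> H H' i x; exact: (is_deriveD (H i x) (H' i x)). Qed.

Lemma has_gradZ (c : R) f g : has_grad f g ->
  has_grad (fun x => c * f x) (fun i x => c * g i x).
Proof. by move=> H i x; exact: (is_deriveZ c (H i x)). Qed.

Lemma C2D f f' : C2 f -> C2 f' -> C2 (fun x => f x + f' x).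
Proof.
move=> /C2_grad[a1 a2 a3 a4 a5] /C2_grad[b1 b2 b3 b4 b5].
apply: (@C2I _ (fun i x => partial f i x + partial f' i x) (fun i j x =>
  partial (partial f i) j x + partial (partial f' i) j x)).
- by move=> x; exact: (cvgD (a1 x) (b1 x)).
- exact: has_gradD.
- by move=> i x; exact: (cvgD (a3 i x) (b3 i x)).
- by move=> i; exact: has_gradD.
- by move=> i j x; exact: (cvgD (a5 i j x) (b5 i j x)).
Qed.

Lemma hessianD f f' x : C2 f -> C2 f' ->
  hessian (fun x => f x + f' x) x = hessian f x + hessian f' x.
Proof.
move=> /C2_grad[a1 a2 a3 a4 a5] /C2_grad[b1 b2 b3 b4 b5].
rewrite (hessianE _ (has_gradD a2 b2) (fun i => has_gradD (a4 i) (b4 i))).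
by apply/matrixP => i j; rewrite mxE [RHS]mxE [X in _ = X + _]mxE [X in _ = _ + X]mxE.
Qed.

Lemma C2Z c f : C2 f -> C2 (fun x => c * f x).
Proof.
move=> /C2_grad[a1 a2 a3 a4 a5].
apply: (@C2I _ (fun i x => c * partial f i x) (fun i j x =>
  c * partial (partial f i) j x)).
- by move=> x; exact: (cvgM (cvg_cst c) (a1 x)).
- exact: has_gradZ.
- by move=> i x; exact: (cvgM (cvg_cst c) (a3 i x)).
- by move=> i; exact: has_gradZ.
- by move=> i j x; exact: (cvgM (cvg_cst c) (a5 i j x)).
Qed.

Lemma hessianZ c f x : C2 f ->
  hessian (fun x => c * f x) x = c *: hessian f x.
Proof.
move=> /C2_grad[a1 a2 a3 a4 a5].
rewrite (hessianE _ (has_gradZ c a2) (fun i => has_gradZ c (a4 i))).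
by apply/matrixP => i j; rewrite mxE [RHS]mxE [X in _ = _ * X]mxE.
Qed.

Lemma C2_cst (c : R) :
  C2 (fun _ : V => c) /\ forall x, hessian (fun _ : V => c) x = 0.
Proof.
have D (d : R) : has_grad (fun _ : V => d) (fun _ _ => 0).
  by move=> i x; exact: is_derive_cst.
split=> [|x].
  apply: (@C2I _ (fun _ _ => 0) (fun _ _ _ => 0)).
  - exact: cst_continuous.
  - exact: D.
  - by move=> i; exact: cst_continuous.
  - by move=> i; exact: D.
  - by move=> i j; exact: cst_continuous.
rewrite (@hessianE _ (fun _ _ => 0) (fun _ _ _ => 0) x (D c) (fun i => D 0)).
by apply/matrixP => i j; rewrite !mxE.
Qed.

End Calculus.

(** * Quadratic forms *)

Section Euclid.
Variables (R : realType) (N : nat).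
Local Notation V := 'rV[R]_N.
Implicit Types (x y z : V) (A : 'M[R]_N).

Definition dotv x y : R := \sum_i x 0 i * y 0 i.
Definition qform A x : R := \sum_i \sum_j A i j * (x 0 i * x 0 j).

Lemma qformE A x : (x *m A *m x^T) 0 0 = qform A x.
Proof.
rewrite mxE /qform exchange_big /=; apply: eq_bigr => j _.
rewrite !mxE mulr_suml; apply: eq_bigr => i _; ring.
Qed.

Lemma dotvE x : (x *m x^T) 0 0 = dotv x x.
Proof. by rewrite mxE; apply: eq_bigr => i _; rewrite mxE. Qed.

Lemma dotv_ge0 x : 0 <= dotv x x.
Proof. by apply: sumr_ge0 => i _; rewrite -expr2 sqr_ge0. Qed.

Lemma dotv0 x : dotv x 0 = 0.
Proof. by apply: big1 => i _; rewrite mxE mulr0. Qed.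

Lemma coord_dotv x i : x 0 i ^+ 2 <= dotv x x.
Proof.
rewrite /dotv (bigD1 i) //= expr2 lerDl; apply: sumr_ge0 => j _.
by rewrite -expr2 sqr_ge0.
Qed.

Lemma norm_coordE x : x != 0 -> exists i, `|x| = `|x 0 i|.
Proof.
move=> x0; have /mx_norm_neq0[[i j] /=] : mx_norm x != 0.
  by apply: contra x0 => /eqP/mx_norm_eq0/eqP.
by rewrite ord1 -[mx_norm x]/(`|x|) => ->; exists j.
Qed.

Lemma norm_le_coord x (c : R) : 0 <= c -> (forall i, `|x 0 i| <= c) -> `|x| <= c.
Proof.
have [->|/norm_coordE[i ->]] := eqVneq x 0; last by move=> _; apply.
by rewrite normr0.
Qed.

Lemma norm_lt_coord x (c : R) : 0 < c -> (forall i, `|x 0 i| < c) -> `|x| < c.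
Proof.
have [->|/norm_coordE[i ->]] := eqVneq x 0; last by move=> _; apply.
by rewrite normr0.
Qed.

(** The norm on row vectors is the maximum norm, whereas radial functions need the Euclidean length.
    This is the bridge: Euclidean balls lie inside balls of the norm. *)
Lemma norm_dotv x : `|x| ^+ 2 <= dotv x x.
Proof.
have [->|/norm_coordE[i ->]] := eqVneq x 0; first by rewrite normr0 expr0n dotv_ge0.
by rewrite real_normK ?num_real // coord_dotv.
Qed.

Lemma coord_norm x i : `|x 0 i| <= `|x|.
Proof.
rewrite -[leRHS]/(mx_norm x) mx_normrE; apply/bigmax_geP; right.
by exists (0, i).
Qed.

Section PSD.
Variable A : 'M[R]_N.
Hypothesis psd : forall x, 0 <= qform A x.
Hypothesis As : A^T = A.

(* Sum over i, j of the form at [z_j e_i - z_i e_j]. *)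
Lemma qform_le_trace z : qform A z <= dotv z z * \tr A.
Proof.
have Asym i j : A i j = A j i by rewrite -[in LHS]As mxE.
have H (i j : 'I_N) : 0 <= A i i * z 0 j ^+ 2 +
  A j j * z 0 i ^+ 2 - 2 * A i j * (z 0 i * z 0 j).
  have [->|ij] := eqVneq i j; first by rewrite le_eqVlt; apply/orP; left; apply/eqP;
    ring.
  pose x : V := \row_k (z 0 j * (k == i)%:R - z 0 i * (k == j)%:R).
  have := psd x; rewrite /qform.
  have S (F : 'I_N -> R) : \sum_k F k * x 0 k = F i * z 0 j - F j * z 0 i.
    rewrite (bigD1 i) //= (bigD1 j) 1?eq_sym //= big1 => [|k /andP[ki kj]].
      rewrite !mxE !eqxx (negbTE ij) [j == i]eq_sym (negbTE ij) !mulr1 !mulr0; ring.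
    by rewrite mxE (negbTE ki) (negbTE kj) !mulr0 subr0 mulr0.
  have -> : \sum_k \sum_l A k l * (x 0 k * x 0 l) =
     \sum_k (\sum_l A k l * x 0 l) * x 0 k.
    by apply: eq_bigr => k _; rewrite mulr_suml; apply: eq_bigr => l _; ring.
  rewrite S !S (Asym j i); set L := (X in 0 <= X -> _); set M := (X in _ -> 0 <= X).
  by have -> : L = M by rewrite /L /M; ring.
have : 0 <= \sum_i \sum_j (A i i * z 0 j ^+ 2 +
  A j j * z 0 i ^+ 2 - 2 * A i j * (z 0 i * z 0 j)).
  by apply: sumr_ge0 => i _; apply: sumr_ge0 => j _.
have -> : \sum_i \sum_j (A i i * z 0 j ^+ 2 +
  A j j * z 0 i ^+ 2 - 2 * A i j * (z 0 i * z 0 j))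
  = 2 * (dotv z z * \tr A) - 2 * qform A z.
  have E1 : \sum_i \sum_j A i i * z 0 j ^+ 2 = dotv z z * \tr A.
    rewrite /mxtrace mulr_sumr; apply: eq_bigr => i _.
    by rewrite -mulr_sumr mulrC; congr (_ * _); apply: eq_bigr => j _; rewrite expr2.
  have E2 : \sum_i \sum_j A j j * z 0 i ^+ 2 = dotv z z * \tr A.
    by rewrite exchange_big.
  have -> : 2 * qform A z = \sum_i \sum_j 2 * A i j * (z 0 i * z 0 j).
    rewrite /qform mulr_sumr; apply: eq_bigr => i _; rewrite mulr_sumr.
    by apply: eq_bigr => j _; rewrite mulrA.
  have -> : 2 * (dotv z z * \tr A) = dotv z z * \tr A + dotv z z * \tr A by ring.
  rewrite -{1}E1 -E2 -big_split -sumrB /=; apply: eq_bigr => i _.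
  by rewrite -big_split -sumrB.
by move=> ?; lra.
Qed.

End PSD.
End Euclid.

(* LDL decomposition: the trace of a product of a positive definite matrix with
   M becomes a positive combination of values of the quadratic form of M. *)
Lemma posdef_decomposition (R : realType) (n : nat) (A : 'M[R]_n) : A^T = A ->
  (forall x : 'rV[R]_n, x != 0 -> 0 < (x *m A *m x^T) 0 0) ->
  exists (m : nat) (c : 'I_m -> R) (xi : 'I_m -> 'rV[R]_n),
    (forall k, 0 <= c k) /\ A = \sum_k c k *: ((xi k)^T *m xi k).
Proof.
elim: n A => [A _ _|n IH].
  exists 0%N, (fun _ => 0), (fun _ => 0); split => //.
  by apply/matrixP => -[].
rewrite -[n.+1]/(1 + n)%N => A As Apos.
set a := ulsubmx A; set b := ursubmx A; set C := drsubmx A.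
have AE : A = block_mx a b b^T C.
  by rewrite -[LHS]submxK /b trmx_ursub As.
pose a0 := a 0 0.
have aE : a = a0%:M by apply/matrixP => i j; rewrite !ord1 [RHS]mxE eqxx.
have a00 : 0 < a0.
  pose e : 'rV[R]_(1 + n) := row_mx 1%:M 0.
  have e0 : e != 0.
    apply/negP => /eqP /(congr1 lsubmx); rewrite row_mxKl linear0 => /matrixP/(_ 0 0).
    by rewrite !mxE /= => /eqP; rewrite oner_eq0.
  have := Apos e e0; rewrite AE /e tr_row_mx trmx1 trmx0 mul_row_block.
  by rewrite !mul1mx !mul0mx !addr0 mul_row_col mulmx1 mulmx0 addr0.
(* The Schur complement of the corner entry; the induction hypothesis decomposes it. *)
pose S := C - a0^-1 *: (b^T *m b).
have Cs : C^T = C.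
  by rewrite /C trmx_drsub As.
have Ss : S^T = S.
  by rewrite /S linearB linearZ /= trmx_mul trmxK Cs.
have Spos (x : 'rV[R]_n) : x != 0 -> 0 < (x *m S *m x^T) 0 0.
  (* This first coordinate makes [a0 y + x b^T] vanish, so the form of [A] at [(y, x)] reduces to
     the form of [S] at [x]. *)
  move=> x0; pose y := - a0^-1 *: (x *m b^T).
  pose e : 'rV[R]_(1 + n) := row_mx y x.
  have e0 : e != 0.
    apply/negP => /eqP /(congr1 rsubmx); rewrite row_mxKr linear0 => /eqP.
    by rewrite (negbTE x0).
  have := Apos e e0; rewrite AE /e tr_row_mx mul_row_block mul_row_col.
  rewrite aE mul_mx_scalar /y.
  have -> : a0 *: (- a0^-1 *: (x *m b^T)) + x *m b^T = 0.
    by rewrite scalerA mulrN mulfV ?gt_eqF // scaleN1r addNr.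
  rewrite mul0mx add0r mulmxDl /S mulmxBr mulmxBl.
  rewrite -!scalemxAl -!scalemxAr !mulmxA scaleNr -!scalemxAl.
  by rewrite [X in 0 < fun_of_matrix X _ _ -> _]addrC.
have [m [c [xi [c0 SE]]]] := IH S Ss Spos.
(* With weight [a0^-1], its square supplies the first row and column of [A] and restores the matrix
   subtracted in [S]. *)
pose x0 : 'rV[R]_(1 + n) := row_mx a0%:M b.
exists m.+1, (fun k => if unlift ord0 k is Some j then c j else a0^-1),
  (fun k => if unlift ord0 k is Some j then row_mx 0 (xi j) else x0).
split.
  by move=> k; case: unliftP => [j _|_] //; rewrite invr_ge0 ltW.
rewrite big_ord_recl unlift_none.
under eq_bigr => i _ do rewrite liftK tr_row_mx trmx0 mul_col_row !mul0mx mulmx0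
  scale_block_mx !scaler0.
have -> : \sum_i block_mx (0 : 'M[R]_1) 0 0 (c i *: ((xi i)^T *m xi i)) =
  block_mx 0 0 0 S.
  rewrite SE; elim/big_rec2: _ => [|i y1 y2 _ ->]; first by rewrite block_mx0.
  by rewrite add_block_mx !addr0.
rewrite /x0 tr_row_mx tr_scalar_mx mul_col_row scale_block_mx add_block_mx !addr0.
rewrite AE aE; congr block_mx.
- by rewrite -scalar_mxM scale_scalar_mx mulrA mulVf ?gt_eqF // mul1r.
- by rewrite mul_scalar_mx scalerA mulVf ?gt_eqF // scale1r.
- by rewrite mul_mx_scalar scalerA mulVf ?gt_eqF // scale1r.
- by rewrite /S addrCA subrr addr0.
Qed.

(** * Second-order conditions, radial functions and trigonometric sums *)

(* Locked because unification would otherwise unfold the derivatives, which are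
   defined as limits by choice. *)
HB.lock Definition lap (R : realType) (N : nat) (A : 'M[R]_N)
  (f : 'rV[R]_N -> R) (x : 'rV[R]_N) : R := \tr (A *m hessian f x).

Section Calculus2.
Variables (R : realType) (N : nat).
Local Notation V := 'rV[R]_N.
Implicit Types (x y z : V) (A : 'M[R]_N).

(** The maximum gives [k1 0 = 0]. If [d] were positive, [k1] would be positive just to the right of
    0, and the mean value theorem would give [k t > k 0] there. *)
Lemma second_derivative_le0 (k k1 : R -> R) (d r : R) : 0 < r ->
  (forall t : R, is_derive t 1 k (k1 t)) -> is_derive (0 : R) 1 k1 d ->
  (forall t, `|t| < r -> k t <= k 0) -> d <= 0.
Proof.
move=> r0 Dk Dk1 km; rewrite leNgt; apply/negP => d0.
have [_ k10] : is_derive (0 : R) 1 k 0.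
  apply: (@derive1_at_max R k (- r) r 0).
  - by rewrite ge0_cp // ltW.
  - by move=> t _; case: (Dk t).
  - by rewrite in_itv /= r0 oppr_lt0 r0.
  - by move=> t; rewrite in_itv /= -ltr_norml => /km.
have {}k10 : k1 0 = 0 by have [_ E] := Dk 0; rewrite -E.
move/is_deriveP: Dk1 => /(_ _ (divr_gt0 d0 (ltr0Sn _ 1)))[r1 r10 H].
pose t := Num.min r r1 / 2.
have t0 : 0 < t by rewrite /t divr_gt0 // lt_min r0 r10.
have m0 : 0 < Num.min r r1 by rewrite lt_min r0 r10.
have tr : t < Num.min r r1 by rewrite /t; lra.
have ck : continuous k.
  by move=> s; apply/differentiable_continuous/derivable1_diffP; case: (Dk s).
have [c cI kc] := MVT t0 (fun s _ => Dk s) (continuous_subspaceT ck).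
move: cI; rewrite in_itv /= => /andP[c0 ct].
move: tr; rewrite lt_min => /andP[tr tr1].
have : `|k1 (0 + c *: 1) - k1 0 - c * d| <= d / 2 * `|c|.
  by apply: H; [rewrite gt_eqF | rewrite gtr0_norm // (lt_trans ct)].
rewrite add0r [c *: 1]mulr1 k10 subr0 (gtr0_norm c0) ler_norml => /andP[H1 _].
have k1c : 0 < k1 c.
  have : 0 < d / 2 * c by rewrite mulr_gt0 // divr_gt0.
  lra.
have := km t; rewrite gtr0_norm // => /(_ tr).
by rewrite -subr_le0 kc subr0 leNgt mulr_gt0.
Qed.

Lemma mxtrace_mul_rank1 (xi : V) (H : 'M[R]_N) :
  \tr ((xi^T *m xi) *m H) = \sum_j xi 0 j * \sum_i xi 0 i * H i j.
Proof.
rewrite -mulmxA mxtrace_mulC trace_mx11 mxE; apply: eq_bigr => j _.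
by rewrite !mxE mulrC.
Qed.

(** The decomposition of [A] turns the trace into a nonnegative combination of second derivatives of
    [f] along lines, each at most 0 at a maximum. *)
Lemma hessian_local_max (f : V -> R) A x : C2 f -> A^T = A ->
  (forall xi : V, xi != 0 -> 0 < (xi *m A *m xi^T) 0 0) ->
  (\forall y \near x, f y <= f x) -> lap A f x <= 0.
Proof.
move=> /C2_grad[cf Df cDf DDf cDDf] As Apos /near_rVP[r r0 fmax].
have [m [c [xi [c0 AE]]]] := posdef_decomposition As Apos.
rewrite lap.unlock AE mulmx_suml raddf_sum /=; apply: sumr_le0 => k _.
rewrite -scalemxAl mxtraceZ mulr_ge0_le0 // mxtrace_mul_rank1.
set v := xi k.
pose d1 y := \sum_i v 0 i * partial f i y.
have Dd1 y : is_derive y v d1 (\sum_j v 0 j * \sum_i v 0 i * partial (partial f j) i y).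
  apply: is_derive_sumf => j; apply: is_deriveZ.
  exact: (is_derive_dir y v (DDf j) (cDDf j)).
have -> : \sum_j v 0 j * \sum_i v 0 i * hessian f x i j =
    \sum_j v 0 j * \sum_i v 0 i * partial (partial f j) i x.
  by apply: eq_bigr => j _; congr (_ * _); apply: eq_bigr => i _; rewrite mxE.
apply: (@second_derivative_le0 (fun t : R => f (x + t *: v))
  (fun t : R => d1 (x + t *: v)) _ (r / (`|v| + 1))).
- by rewrite divr_gt0 // ltr_wpDl.
- by move=> t; apply: is_derive_line_at; apply: is_derive_dir.
- by apply/is_derive_line; exact: Dd1.
- move=> t tr; rewrite scale0r addr0; apply: fmax.
  rewrite addrAC subrr add0r normrZ.
  move: tr; rewrite ltr_pdivlMr ?ltr_wpDl //; apply: le_lt_trans.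
  by apply: ler_wpM2l => //; rewrite lerDl.
Qed.

Lemma continuous_dotv (f g : V -> V) : (forall i, continuous (fun x => f x 0 i)) ->
  (forall i, continuous (fun x => g x 0 i)) -> continuous (fun x => dotv (f x) (g x)).
Proof.
move=> cf cg; apply: continuous_sumf => i x.
exact: (cvgM (cf i x) (cg i x)).
Qed.

Lemma continuous_dist2 y : continuous (fun x => dotv (x - y) (x - y)).
Proof.
have H i : continuous (fun x : V => (x - y) 0 i).
  have -> : (fun x : V => (x - y) 0 i) = (fun x : V => x 0 i - y 0 i).
    by apply/funext => x; rewrite !mxE.
  by move=> x; apply: (cvgB (@coord_continuous _ _ _ 0 i x) (cvg_cst _)).
exact: continuous_dotv.
Qed.

Lemma is_derive_dist2 y i x :
  is_derive x (basis_vec R i) (fun x => dotv (x - y) (x - y)) (2 * (x - y) 0 i).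
Proof.
have D j : is_derive x (basis_vec R i) (fun x : V => (x - y) 0 j) (j == i)%:R.
  have -> : (fun x : V => (x - y) 0 j) = (fun x : V => x 0 j) - cst (y 0 j).
    by apply/funext => z; rewrite !mxE.
  apply: is_derive_eq (is_deriveB (is_derive_coord _ _ _) (is_derive_cst _ _ _)) _.
  by rewrite subr0 mxE eqxx.
apply: is_derive_eq.
  by apply: is_derive_sumf => j; exact: (is_deriveM (D j) (D j)).
rewrite (bigD1 i) //= big1 => [|j /negbTE ->]; last by rewrite !scaler0 addr0.
by rewrite eqxx addr0 [_ *: 1]mulr1; ring.
Qed.

(** Profiles are functions of the squared distance, so no singularity arises at the centre. The
    derivatives at [s = 0] are two-sided, hence a profile must be smooth slightly beyond 0. *)
Lemma C2_radial (g g1 g2 : R -> R) y :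
  (forall s : R, 0 <= s -> is_derive s 1 g (g1 s)) ->
  (forall s : R, 0 <= s -> is_derive s 1 g1 (g2 s)) ->
  (forall s : R, 0 <= s -> {for s, continuous g2}) ->
  C2 (fun x => g (dotv (x - y) (x - y))) /\
  forall x, hessian (fun x => g (dotv (x - y) (x - y))) x =
    (4 * g2 (dotv (x - y) (x - y))) *: ((x - y)^T *m (x - y)) +
    (2 * g1 (dotv (x - y) (x - y)))%:M.
Proof.
move=> Dg Dg1 cg2.
pose s x := dotv (x - y) (x - y).
have s0 x : 0 <= s x by exact: dotv_ge0.
have ds := is_derive_dist2 y.
pose G i x := g1 (s x) * (2 * (x - y) 0 i).
pose H i j x := g2 (s x) * (2 * (x - y) 0 j) * (2 * (x - y) 0 i) +
  g1 (s x) * (2 * (i == j)%:R).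
have DG : has_grad (fun x => g (s x)) G.
  by move=> i x; exact: (is_derive_comp1 (Dg _ (s0 x)) (ds i x)).
have Dc i j x : is_derive x (basis_vec R j) (fun x : V =>
  2 * (x - y) 0 i) (2 * (i == j)%:R).
  have -> : (fun x : V => 2 * (x - y) 0 i) = 2 *: ((fun x : V => x 0 i) - cst (y 0 i)).
    by apply/funext => z; rewrite !mxE.
  apply: is_derive_eq (is_deriveZ _ (is_deriveB (is_derive_coord _ _ _)
    (is_derive_cst _ _ _))) _.
  by rewrite subr0 mxE eqxx.
have DH i : has_grad (G i) (H i).
  move=> j x; apply: is_derive_eq (is_deriveM (is_derive_comp1 (Dg1 _ (s0 x)) (ds j
    x)) (Dc i j x)) _.
  by rewrite addrC /GRing.scale /= /H mulrC.
have cs : continuous s by exact: continuous_dist2.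
have cpt (k : R -> R) : (forall t, 0 <= t -> {for t, continuous k}) ->
  continuous (fun x => k (s x)).
  by move=> ck x; apply: continuous_comp; [exact: cs | exact: ck].
have cder (k k' : R -> R) : (forall t : R, 0 <= t -> is_derive t 1 k (k' t)) ->
   forall t, 0 <= t -> {for t, continuous k}.
  by move=> Dk t t0; apply/differentiable_continuous/derivable1_diffP; case: (Dk t t0).
have cc i : continuous (fun x : V => 2 * (x - y) 0 i).
  have -> : (fun x : V => 2 * (x - y) 0 i) = (fun x : V => 2 * (x 0 i - y 0 i)).
    by apply/funext => x; rewrite !mxE.
  by move=> x; exact: (cvgM (cvg_cst _) (cvgB (@coord_continuous _ _ _ 0 i x)
    (cvg_cst _))).
split.
  apply: (@C2I _ _ _ G H) => //.
  - exact/cpt/(cder _ _ Dg).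
  - by move=> i x; exact: (cvgM (cpt _ (cder _ _ Dg1) x) (cc i x)).
  - move=> i j x; apply: (cvgD (cvgM (cvgM (cpt _ cg2 x) (cc j x)) (cc i x)) (cvgM
      (cpt _ (cder _ _ Dg1) x) (cvg_cst _))).
move=> x; rewrite (hessianE _ DG DH); apply/matrixP => i j.
rewrite mxE [RHS]mxE [X in _ = X + _]mxE [X in _ = _ + X]mxE [X in _ = _ * X + _]mxE.
rewrite big_ord1 [(x - y)^T i 0]mxE /H /s -mulr_natr [j == i]eq_sym; ring.
Qed.

(** Real trigonometric sums with arbitrary frequency vectors; the phase [d] lets cosines alone cover
    sines and constants. *)
Inductive trig : (V -> R) -> Prop :=
| trig_cos k d : trig (fun x => cos (dotv k x + d))
| trig_add f g : trig f -> trig g -> trig (fun x => f x + g x)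
| trig_scale c f : trig f -> trig (fun x => c * f x).

Lemma is_derive_phase k d i x : is_derive x (basis_vec R i) (fun x =>
  dotv k x + d) (k 0 i).
Proof.
have -> : (fun x => dotv k x + d) = (fun x => dotv k x) + cst d by [].
rewrite -[k 0 i]addr0; apply: is_deriveD.
apply: is_derive_eq.
  by apply: is_derive_sumf => j; apply: is_deriveZ; exact: is_derive_coord.
rewrite (bigD1 i) //= big1 => [|j ji]; last by rewrite mxE (negbTE ji) andbF scaler0.
by rewrite mxE !eqxx addr0 [_ *: _]mulr1.
Qed.

Lemma trig_cosE k d : C2 (fun x => cos (dotv k x + d)) /\
  forall x, hessian (fun x => cos (dotv k x + d)) x =
    - cos (dotv k x + d) *: (k^T *m k).
Proof.
pose G i x := - sin (dotv k x + d) * k 0 i.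
pose H i j x := - cos (dotv k x + d) * k 0 j * k 0 i.
have DG : has_grad (fun x => cos (dotv k x + d)) G.
  by move=> i x; exact: (is_derive_comp1 (is_derive_cos _) (is_derive_phase k d i x)).
have DH i : has_grad (G i) (H i).
  move=> j x.
  have E : (- k 0 i) *: (sin \o (fun x => dotv k x + d)) = G i.
    by apply/funext => z; transitivity ((- k 0 i) * sin (dotv k z + d));
      rewrite // /G; ring.
  rewrite -E; apply: is_derive_eq (is_deriveZ (- k 0 i)
    (is_derive_comp1 (is_derive_sin _) (is_derive_phase k d j x))) _.
  by transitivity ((- k 0 i) * (cos (dotv k x + d) * k 0 j)); rewrite // /H; ring.
have cp : continuous (fun x => dotv k x + d).
  have c1 : continuous (fun x => dotv k x).
    by apply: (@continuous_dotv (fun _ => k) id) => i;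
      [exact: cst_continuous | exact: coord_continuous].
  by move=> x; exact: (cvgD (c1 x) (cvg_cst d)).
have cC : continuous (fun x => cos (dotv k x + d)).
  by move=> x; apply: continuous_comp; [exact: cp | exact: continuous_cos].
have cS : continuous (fun x => sin (dotv k x + d)).
  by move=> x; apply: continuous_comp; [exact: cp | exact: continuous_sin].
split.
  apply: (@C2I _ _ _ G H) => //.
  - by move=> i x; exact: (cvgM (cvgN (cS x)) (cvg_cst _)).
  - by move=> i j x; exact: (cvgM (cvgM (cvgN (cC x)) (cvg_cst _)) (cvg_cst _)).
move=> x; rewrite (hessianE _ DG DH); apply/matrixP => i j.
rewrite mxE [RHS]mxE [X in _ = _ * X]mxE big_ord1 [k^T i 0]mxE /H; ring.
Qed.

Lemma trig_C2 p : trig p -> C2 p.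
Proof.
elim=> [k d|f g _ Hf _ Hg|c f _ Hf].
- exact: (trig_cosE k d).1.
- exact: C2D.
- exact: C2Z.
Qed.

Lemma trig_bounded p : trig p -> exists B : R, forall x, `|p x| <= B.
Proof.
elim=> [k d|f g _ [B1 H1] _ [B2 H2]|c f _ [B H]].
- by exists 1 => x; rewrite ler_norml cos_geN1 cos_le1.
- by exists (B1 + B2) => x; apply: le_trans (ler_normD _ _) _; exact: lerD.
- by exists (`|c| * B) => x; rewrite normrM ler_wpM2l.
Qed.

Lemma trig_cst c : trig (fun _ => c).
Proof.
have -> : (fun _ : V => c) = (fun x => c * cos (dotv 0 x + 0)).
  apply/funext => x; rewrite /dotv big1 ?addr0 ?cos0 ?mulr1 // => i _.
  by rewrite mxE mul0r.
by apply: trig_scale; exact: trig_cos.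
Qed.

(** Product-to-sum formula on two modes, extended by bilinearity. It makes polynomials in sines of
    the coordinates trigonometric. *)
Lemma trig_mul p q : trig p -> trig q -> trig (fun x => p x * q x).
Proof.
move=> tp; elim: tp q => [k d|f g _ Hf _ Hg|c f _ Hf] q tq.
- have E (a b a' b' : R) : a * b = 2^-1 * ((a * b - a' * b') + (a * b + a' * b'))
    by field.
  elim: tq => [l e|f g _ Hf _ Hg|c f _ Hf].
  + have -> : (fun x => cos (dotv k x + d) * cos (dotv l x + e)) = (fun x =>
      2^-1 * (cos (dotv (k + l) x + (d + e)) + cos (dotv (k - l) x + (d - e)))).
      apply/funext => x.
      have -> : dotv (k + l) x + (d + e) = (dotv k x + d) + (dotv l x + e).
        rewrite addrACA; congr (_ + _); rewrite /dotv -big_split /=.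
        by apply: eq_bigr => i _; rewrite mxE mulrDl.
      have -> : dotv (k - l) x + (d - e) = (dotv k x + d) - (dotv l x + e).
        rewrite opprD addrACA; congr (_ + _); rewrite /dotv -sumrB.
        by apply: eq_bigr => i _; rewrite !mxE mulrBl.
      rewrite (cosB (dotv k x + d)) (cosD (dotv k x + d)).
      by apply: E.
    by apply: trig_scale; apply: trig_add; exact: trig_cos.
  + under eq_fun => x do rewrite mulrDr.
    exact: trig_add.
  + under eq_fun => x do rewrite mulrCA.
    exact: trig_scale.
- under eq_fun => x do rewrite mulrDl.
  by apply: trig_add; [exact: Hf | exact: Hg].
- under eq_fun => x do rewrite -mulrA.
  by apply: trig_scale; exact: Hf.
Qed.

Lemma trig_sin_coord i (a : R) : trig (fun x => sin (x 0 i - a)).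
Proof.
have -> : (fun x : V => sin (x 0 i - a)) = (fun x =>
  cos (dotv (basis_vec R i) x + (- a - pi / 2))).
  apply/funext => x.
  have -> : dotv (basis_vec R i) x = x 0 i.
    rewrite /dotv (bigD1 i) //= big1 => [|j ji];
      last by rewrite mxE (negbTE ji) andbF mul0r.
    by rewrite mxE !eqxx mul1r addr0.
  by rewrite addrA cosB cos_pihalf sin_pihalf mulr0 mulr1 add0r.
exact: trig_cos.
Qed.

Lemma mxtrace_qform A (k : V) : \tr (A *m (k^T *m k)) = qform A k.
Proof. by rewrite mulmxA mxtrace_mulC mulmxA trace_mx11 qformE. Qed.

Lemma lapE A (f : V -> R) x : lap A f x = \tr (A *m hessian f x).
Proof. by rewrite lap.unlock. Qed.

Lemma lapD A (f g : V -> R) x : C2 f -> C2 g ->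
  lap A (fun x => f x + g x) x = lap A f x + lap A g x.
Proof. by move=> Cf Cg; rewrite !lapE hessianD // mulmxDr mxtraceD. Qed.

Lemma lapZ A c (f : V -> R) x : C2 f -> lap A (fun x => c * f x) x = c * lap A f x.
Proof. by move=> Cf; rewrite !lapE hessianZ // -scalemxAr mxtraceZ. Qed.

Lemma lap_cst A c x : lap A (fun _ : V => c) x = 0.
Proof. by rewrite lapE (C2_cst N c).2 mulmx0 mxtrace0. Qed.

(** On the mode of frequency [k] the operator is multiplication by [1 + tau * qform A k], which is
    at least 1 and is inverted by division. *)
Lemma trig_resolvent A (tau : R) p : (forall k : V, 0 <= qform A k) -> 0 <= tau ->
  trig p ->
  exists2 h, trig h & forall x, h x - tau * lap A h x = p x.
Proof.
move=> psd tau0; elim=> [k d|f g _ [h1 t1 H1] _ [h2 t2 H2]|c f _ [h t H]].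
- have q0 : 0 < 1 + tau * qform A k by rewrite ltr_wpDr // mulr_ge0.
  exists (fun x => (1 + tau * qform A k)^-1 * cos (dotv k x + d)).
    by apply: trig_scale; exact: trig_cos.
  have [C HE] := trig_cosE k d.
  move=> x; rewrite lapZ // lapE HE -scalemxAr mxtraceZ mxtrace_qform.
  by field; rewrite gt_eqF.
- exists (fun x => h1 x + h2 x); first exact: trig_add.
  move=> x; rewrite lapD; [|exact: trig_C2 ..].
  by rewrite mulrDr -H1 -H2 opprD addrACA.
- exists (fun x => c * h x); first exact: trig_scale.
  move=> x; rewrite lapZ; last exact: trig_C2.
  by rewrite -H mulrBr mulrCA.
Qed.

End Calculus2.

(** * Comparison for the resolvent equation *)

Section Compactness.
Variables (R : realType) (N : nat).
Local Notation V := 'rV[R]_N.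
Implicit Types (x y z : V) (K : set V).

(** Here [x] is confined to [K] while [y] may leave it, as the points entering an average around [x]
    do. *)
Lemma uniformly_continuous_on_compact (f : V -> R) K (e : R) :
  continuous f -> compact K -> 0 < e ->
  exists2 d : R, 0 < d & forall x y, K x -> `|y - x| < d -> `|f y - f x| < e.
Proof.
move=> cf /compact_near_coveringP cK e0.
have [] := cK R (at_right 0) (fun (d : R) (x : V) =>
  forall y, `|y - x| < d -> `|f y - f x| < e) _ _.
  move=> x _; have /continuousPnorm/(_ x (e / 2) (divr_gt0 e0 (ltr0Sn _ 1)))[r r0 H]
    := cf.
  have r20 : 0 < r / 2 by rewrite divr_gt0.
  exists ([set x' | `|x' - x| < r / 2], [set d : R | d < r / 2]) => /=.
    split; first by apply/near_rVP; exists (r / 2).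
    by apply: nbhs_right_lt.
  move=> [x' d] [/= xx' dr] y yd.
  have y1 : `|f y - f x| < e / 2.
    apply: H; have -> : y - x = (y - x') + (x' - x) by rewrite addrA subrK.
    apply: le_lt_trans (ler_normD _ _) _; lra.
  have x1 : `|f x' - f x| < e / 2 by apply: H; lra.
  have -> : f y - f x' = (f y - f x) - (f x' - f x) by lra.
  apply: le_lt_trans (ler_normB _ _) _; lra.
move=> r /= r0 H; exists (r / 2); first by rewrite divr_gt0.
move=> x y Kx; apply: H => //=.
  by rewrite sub0r normrN gtr0_norm ?divr_gt0 // ltr_pdivrMr // mulr_natr mulr2n ltrDl.
by rewrite divr_gt0.
Qed.

Lemma compact_le (g : V -> R) (c M : R) : continuous g ->
  (forall x, g x <= c -> `|x| <= M) -> compact [set x | g x <= c].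
Proof.
move=> cg H; apply: bounded_closed_compact.
  exists M; split; first exact: num_real.
  by move=> M' MM' x /= /H /le_trans; apply; exact: ltW.
exact: (preimage_closed (fun x _ => cg x) (@closed_le R c)).
Qed.

Lemma norm_le_dotv x (c : R) : 0 <= c -> dotv x x <= c ^+ 2 -> `|x| <= c.
Proof.
move=> c0 H; rewrite -(@ler_pXn2r _ 2) ?nnegrE //.
exact: le_trans (norm_dotv x) H.
Qed.

Lemma compact_ball2 y (c : R) : 0 <= c ->
  compact [set x | dotv (x - y) (x - y) <= c ^+ 2].
Proof.
move=> c0; apply: (@compact_le _ _ (c + `|y|)); first exact: continuous_dist2.
move=> x /(norm_le_dotv c0) H; rewrite -[x in `|x|](subrK y).
by apply: le_trans (ler_normD _ _) _; rewrite lerD2r.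
Qed.

Lemma continuous_norm_sub y : continuous (fun x : V => `|x - y|).
Proof.
move=> x; apply/(@cvgrPdist_lt _ _ _ _ (nbhs_filter x)) => e e0; apply/near_rVP.
exists e => // z zx; apply: le_lt_trans (ler_dist_dist _ _) _.
rewrite (_ : x - y - (z - y) = - (z - x)) ?normrN //.
by rewrite !opprB addrA subrK.
Qed.

Lemma compact_ball_norm y (c : R) : compact [set x | `|x - y| <= c].
Proof.
apply: (@compact_le _ _ (c + `|y|)); first exact: continuous_norm_sub.
move=> x H; rewrite -[x in `|x|](subrK y).
by apply: le_trans (ler_normD _ _) _; rewrite lerD2r.
Qed.

Lemma near_dotv_lt x y (c : R) : dotv (x - y) (x - y) < c ->
  \forall z \near x, dotv (z - y) (z - y) < c.
Proof.
move=> H; have := @continuous_dist2 R N y x.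
by move=> /(@cvgr_lt _ _ _ (nbhs_filter x)) /(_ _ H).
Qed.

End Compactness.

Lemma is_derive_quadratic (R : realType) (k a b s : R) :
  is_derive s 1 (fun t : R => k * t ^+ 2 + a * t + b) (2 * k * s + a).
Proof.
apply/is_deriveP => e e0; exists (e / (`|k| + 1)).
  by rewrite divr_gt0 // ltr_wpDl.
move=> t _; rewrite ltr_pdivlMr ?ltr_wpDl // [t *: 1]mulr1 => te.
have -> : k * (s + t) ^+ 2 + a * (s + t) + b - (k * s ^+ 2 + a * s +
  b) - t * (2 * k * s + a)
  = (k * t) * t by ring.
rewrite normrM ler_wpM2r // normrM mulrC; apply: le_trans (ltW te).
by rewrite ler_wpM2l // lerDl.
Qed.

Section Elliptic.
Variables (R : realType) (N : nat) (lam Lam : R).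
Hypotheses (lam0 : 0 < lam) (lamLam : lam <= Lam).
Local Notation V := 'rV[R]_N.
Implicit Types (x y z : V) (A : 'M[R]_N).

Lemma ellipticityP A : ellipticity_set lam Lam A <-> A^T = A /\
  forall x, lam * dotv x x <= qform A x <= Lam * dotv x x.
Proof.
split=> -[As H]; split=> // x; have := H x; rewrite qformE dotvE.
  by move=> [-> ->].
by move=> /andP.
Qed.

Lemma elliptic_ge0 A : ellipticity_set lam Lam A -> forall x, 0 <= qform A x.
Proof.
move=> /ellipticityP[_ H] x; have /andP[+ _] := H x.
by apply: le_trans; rewrite mulr_ge0 ?dotv_ge0 // ltW.
Qed.

Lemma dotv_gt0 x : x != 0 -> 0 < dotv x x.
Proof.
move=> x0; apply: lt_le_trans (norm_dotv x).
by rewrite exprn_gt0 // normr_gt0.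
Qed.

Lemma elliptic_gt0 A : ellipticity_set lam Lam A ->
  forall x, x != 0 -> 0 < (x *m A *m x^T) 0 0.
Proof.
move=> /ellipticityP[_ H] x /dotv_gt0 x0; rewrite qformE; have /andP[+ _] := H x.
by apply: lt_le_trans; rewrite mulr_gt0.
Qed.

Lemma qform_basis A i : qform A (basis_vec R i) = A i i.
Proof.
rewrite /qform (bigD1 i) //= [X in _ + X]big1 => [|j ji]; last first.
  by apply: big1 => k _; rewrite mxE (negbTE ji) andbF mul0r mulr0.
rewrite (bigD1 i) //= [X in _ + X + _]big1 => [|j ji]; last first.
  by rewrite ![basis_vec R i 0 j]mxE (negbTE ji) andbF !mulr0.
by rewrite mxE !eqxx !mulr1 !addr0.
Qed.

Lemma dotv_basis (i : 'I_N) : dotv (basis_vec R i) (basis_vec R i) = 1.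
Proof.
rewrite /dotv (bigD1 i) //= [X in _ + X]big1 => [|j ji]; last first.
  by rewrite mxE (negbTE ji) andbF mul0r.
by rewrite mxE !eqxx !mulr1 addr0.
Qed.

Lemma elliptic_trace A : ellipticity_set lam Lam A ->
  N%:R * lam <= \tr A <= N%:R * Lam.
Proof.
move=> /ellipticityP[_ H].
have S (c : R) : N%:R * c = \sum_(i < N) c by rewrite sumr_const card_ord mulr_natl.
rewrite !S; apply/andP; split; apply: ler_sum => i _;
  by have := H (basis_vec R i); rewrite qform_basis dotv_basis !mulr1 => /andP[].
Qed.

(** The viscosity inequality at one point for a single linear operator and a frozen right-hand side:
    the form that averaging can preserve. *)
Definition lin_sub_at A (u : V -> R) (F : R) x0 := forall phi, C2 phi ->
  (\forall x \near x0, u x - phi x <= u x0 - phi x0) ->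
  - lap A phi x0 <= F.

Lemma C2_lin_sub_at A (f : V -> R) F x0 : ellipticity_set lam Lam A -> C2 f ->
  - lap A f x0 <= F -> lin_sub_at A f F x0.
Proof.
move=> eA Cf fF phi Cp H; apply: le_trans fF; rewrite lerN2 -subr_le0.
have CN : C2 (fun x => -1 * phi x) by exact: C2Z.
rewrite -mulN1r -lapZ // -lapD //.
apply: hessian_local_max (elliptic_gt0 eA) _; [exact: C2D | by case: eA |].
by near=> x; rewrite !mulN1r; near: x.
Unshelve. all: by end_near. Qed.

(* The barrier [K (s^2 + c tau s + c' tau^2)], [s = |x - y|^2], is a
   supersolution of the resolvent equation: it dominates the unknown boundary
   values but contributes only [O(tau^2)] at the centre. *)
Lemma resolvent_comparison A (u h p : V -> R) y (r tau F err M K : R) :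
  let c := 4 * N%:R * Lam + 8 * Lam in
  let c' := 2 * N%:R * Lam * c in
  ellipticity_set lam Lam A -> 0 < r -> 0 <= tau -> 0 <= K ->
  continuous u -> C2 h ->
  (forall x, h x - tau * lap A h x = p x) ->
  (forall x, dotv (x - y) (x - y) < r ^+ 2 -> lin_sub_at A u F x) ->
  (forall x, dotv (x - y) (x - y) <= r ^+ 2 -> u x - p x <= err) ->
  (forall x, dotv (x - y) (x - y) <= r ^+ 2 -> u x - h x <= M) ->
  M - K * r ^+ 4 <= err + tau * F ->
  u y - h y <= err + tau * F + K * c' * tau ^+ 2.
Proof.
move=> c c' eA r0 tau0 K0 cu Ch hp usub uperr uM MK.
have N0 : 0 <= N%:R :> R by [].
have Lam0 : 0 < Lam by exact: lt_le_trans lamLam.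
have c0 : 0 <= c by rewrite /c; nra.
have c'0 : 0 <= c' by rewrite /c' !mulr_ge0 // ltW.
(* The trace of [A] against the Hessian is at most [K c s] for the term [K s^2] and at most
   [K c' tau] for the term [K c tau s]. After multiplication by [tau] these are the last two terms
   of [g]. *)
pose g (s : R) := K * s ^+ 2 + K * c * tau * s + K * c' * tau ^+ 2.
pose g1 (s : R) := 2 * K * s + K * c * tau.
pose g2 (s : R) := 2 * K.
have Dg (s : R) : is_derive s 1 g (g1 s).
  exact: is_derive_quadratic.
have Dg1 (s : R) : is_derive s 1 g1 (g2 s).
  have := is_derive_quadratic 0 (2 * K) (K * c * tau) s.
  have -> : (fun t : R => 0 * t ^+ 2 + 2 * K * t + K * c * tau) = g1.
    by apply/funext => t; rewrite /g1; ring.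
  by rewrite mulr0 mul0r add0r.
have [Cb Hb] := @C2_radial R N g g1 g2 y (fun s _ => Dg s) (fun s _ =>
  Dg1 s) (fun s _ => cvg_cst _).
set b := (fun x => g (dotv (x - y) (x - y))) in Cb Hb.
have bE x : b x = g (dotv (x - y) (x - y)) by [].
clearbody b.
pose D := [set x | dotv (x - y) (x - y) <= r ^+ 2].
have cD : compact D by apply: compact_ball2; exact: ltW.
have Dy : D y by rewrite /D /= subrr dotv0 sqr_ge0.
have cf : continuous (fun x => u x - (h x + b x)).
  by move=> x; apply: (cvgB (cu x) (cvgD (Ch.1 x) (Cb.1 x))).
have [x1 /set_mem Dx1 x1max] := EVT_max_rV (ex_intro _ y Dy) cD (continuous_subspaceT
  cf).
(* At a maximum on the boundary the barrier exceeds [K r^4], which absorbs [M]. At an interior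
   maximum [h + b] tests [u]; substituting [h = p + tau * lap A h] leaves [tau * lap A b - b <= 0]
   besides [err + tau * F]. *)
have bound : u x1 - (h x1 + b x1) <= err + tau * F.
  have [int|bd] := ltP (dotv (x1 - y) (x1 - y)) (r ^+ 2); last first.
    have E : dotv (x1 - y) (x1 - y) = r ^+ 2 by apply/eqP; rewrite eq_le bd andbT.
    have : K * r ^+ 4 <= b x1.
      rewrite bE E /g -exprM -addrA lerDl.
      by rewrite addr_ge0 // !mulr_ge0 // ltW.
    have := uM x1; rewrite E => /(_ (lexx _)); lra.
  have Chb := C2D Ch Cb.
  have := usub x1 int _ Chb; set P := (X in (X -> _) -> _) => H.
  have HP : P.
    near=> x; apply: x1max; rewrite inE /D /=; apply: ltW; near: x.
    exact: near_dotv_lt.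
  move: (H HP); rewrite lapD // => HF.
  have := uperr x1 Dx1; rewrite -hp.
  set th := lap A h x1 in HF *; set tb := lap A b x1 in HF *.
  move=> Hp.
  have Htb : tau * tb <= b x1.
    set s := dotv (x1 - y) (x1 - y) in int.
    have s0 : 0 <= s by exact: dotv_ge0.
    have -> : tb = 8 * K * qform A (x1 - y) + 2 * g1 s * \tr A.
      rewrite /tb lapE Hb mulmxDr mxtraceD -scalemxAr mxtraceZ mxtrace_qform.
      by rewrite mul_mx_scalar mxtraceZ /g2 -/s; ring.
    have /ellipticityP[_ /(_ (x1 - y)) /andP[_ q1]] := eA.
    have /andP[_ t1] := elliptic_trace eA.
    have q2 : 8 * K * qform A (x1 - y) <= 8 * K * (Lam * s) by apply: ler_wpM2l =>
      //; exact: mulr_ge0.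
    have g10 : 0 <= g1 s by rewrite /g1 addr_ge0 // !mulr_ge0.
    have t2 : 2 * g1 s * \tr A <= 2 * g1 s * (N%:R * Lam).
      by apply: ler_wpM2l => //; exact: mulr_ge0.
    have H3 : 8 * K * qform A (x1 - y) + 2 * g1 s * \tr A <= K * (c * s + c' * tau).
      apply: le_trans (lerD q2 t2) _; rewrite /g1 /c' /c le_eqVlt; apply/orP; left;
        apply/eqP; ring.
    apply: le_trans (ler_wpM2l tau0 H3) _.
    rewrite bE -/s /g -addrA.
    have -> : tau * (K * (c * s + c' * tau)) = K * c * tau * s + K * c' * tau ^+ 2
      by ring.
    by rewrite lerDr mulr_ge0 // sqr_ge0.
  have : tau * - (th + tb) <= tau * F by exact: ler_wpM2l.
  lra.
have /= := x1max y (mem_set Dy).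
have -> : b y = K * c' * tau ^+ 2 by rewrite bE subrr dotv0 /g; ring.
lra.
Unshelve. all: by end_near. Qed.

(* The radius of the comparison ball tends to infinity. *)
Lemma resolvent_bound A (h p : V -> R) (tau M B : R) : ellipticity_set lam Lam A ->
  0 <= tau -> C2 h -> (forall x, h x - tau * lap A h x = p x) ->
  (forall x, p x <= M) -> (forall x, h x <= B) -> forall x, h x <= M.
Proof.
move=> eA tau0 Ch hp pM hB y; apply/ler_addgt0Pr => e e0.
pose c' := 2 * N%:R * Lam * (4 * N%:R * Lam + 8 * Lam).
have Lam0 : 0 < Lam by exact: lt_le_trans lamLam.
have c'0 : 0 <= c' by rewrite /c' !mulr_ge0 ?addr_ge0 ?mulr_ge0 // ltW.
pose L := `|B - M| * c' * tau ^+ 2.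
have L0 : 0 <= L by exact: (mulr_ge0 (mulr_ge0 (normr_ge0 _) c'0) (sqr_ge0 tau)).
(* Since [r >= 1], one has [r <= r^4], hence [L / r^4 <= e]. *)
pose r := Num.max 1 (L / e).
have r1 : 1 <= r by rewrite le_max lexx.
have r0 : 0 < r by apply: lt_le_trans r1.
have CN : C2 (fun x => -1 * h x) by exact: C2Z.
have CC := (C2_cst N (- M)).1.
(* The constant [- M] is a subsolution with [F = 0] and lies below [- p], so [err = 0]; the crude
   bound [B] only enters through the size of [K]. *)
have := @resolvent_comparison A (fun _ => - M) (fun x => -1 * h x) (fun x => - p x)
  y r tau 0 0 (B - M) (`|B - M| / r ^+ 4) eA r0 tau0.
rewrite -/c' mulr0 !add0r divfK ?gt_eqF ?exprn_gt0 // => H.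
have {}H : - M - -1 * h y <= `|B - M| / r ^+ 4 * c' * tau ^+ 2.
  apply: H.
  - by rewrite divr_ge0 // exprn_ge0 // ltW.
  - exact: cst_continuous.
  - exact: CN.
  - by move=> x; rewrite lapZ // -hp; ring.
  - by move=> x _; apply: C2_lin_sub_at => //; rewrite lap_cst oppr0.
  - by move=> x _; have := pM x; lra.
  - by move=> x _; have := hB x; lra.
  - by rewrite subr_le0 ler_norm.
move: H.
have -> : `|B - M| / r ^+ 4 * c' * tau ^+ 2 = L / r ^+ 4 by rewrite /L; ring.
have : L / r ^+ 4 <= e.
  rewrite ler_pdivrMr ?exprn_gt0 //.
  have : L / e <= r by rewrite le_max lexx orbT.
  rewrite ler_pdivrMr // => /le_trans; apply.
  rewrite mulrC; apply: ler_wpM2l; first exact: ltW.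
  by rewrite -[leLHS]expr1; apply: ler_weXn2l.
lra.
Qed.

End Elliptic.

(** * Approximation by trigonometric sums *)

Section TrigApproximation.
Variables (R : realType) (N : nat).
Local Notation V := 'rV[R]_N.
Implicit Types (s x y Y : V) (l : seq 'I_N).

(* Expectation of [f] at the end of the random walk started at [Y] whose
   successive steps, one for each [i] in [l], are [st e_i] with probability
   [s_i] and 0 otherwise. For [l] containing each index [n] times this is the
   multivariate Bernstein operator. *)
Fixpoint walk s (st : R) l (f : V -> R) Y : R :=
  if l is i :: l' then
    s 0 i * walk s st l' f (Y + st *: basis_vec R i) + (1 - s 0 i) * walk s st l' f Y
  else f Y.

Lemma walk_le s st l (f g : V -> R) Y : (forall i, 0 <= s 0 i <= 1) ->
  (forall y, f y <= g y) -> walk s st l f Y <= walk s st l g Y.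
Proof.
move=> s01 fg; elim: l Y => [|i l IH] Y //=.
have /andP[s0 s1] := s01 i.
by apply: lerD; apply: ler_wpM2l; rewrite ?subr_ge0 ?IH.
Qed.

Lemma walk_cst s st l (c : R) Y : walk s st l (fun _ => c) Y = c.
Proof. by elim: l Y => [|i l IH] Y //=; rewrite !IH; ring. Qed.

Lemma walkD s st l (f g : V -> R) Y :
  walk s st l (fun y => f y + g y) Y = walk s st l f Y + walk s st l g Y.
Proof. by elim: l Y => [|i l IH] Y //=; rewrite !IH; ring. Qed.

Lemma walkZ s st l c (f : V -> R) Y :
  walk s st l (fun y => c * f y) Y = c * walk s st l f Y.
Proof. by elim: l Y => [|i l IH] Y //=; rewrite !IH; ring. Qed.

Lemma walk_sum (I : Type) (r : seq I) s st l (f : I -> V -> R) Y :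
  walk s st l (fun y => \sum_(i <- r) f i y) Y = \sum_(i <- r) walk s st l (f i) Y.
Proof.
elim: r => [|i r IH].
  rewrite big_nil -[RHS](walk_cst s st l 0 Y); congr walk.
  by apply/funext => y; rewrite big_nil.
rewrite big_cons -IH -walkD; congr walk.
by apply/funext => y; rewrite big_cons.
Qed.

(** Squared bias plus variance: coordinate [j] performs [m] independent Bernoulli steps of size
    [st]. *)
Lemma walk_second_moment s st l (j : 'I_N) (b : R) Y : let m := (count_mem j l)%:R in
  walk s st l (fun y => (y 0 j - b) ^+ 2) Y =
  (Y 0 j + m * st * s 0 j - b) ^+ 2 + m * st ^+ 2 * s 0 j * (1 - s 0 j).
Proof.
elim: l Y => [|i l IH] Y /=; first by ring.
rewrite !IH !mxE natrD; have [->|ij] := eqVneq i j.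
  by rewrite !eqxx /= -[true%:R]/(1%:R); ring.
by rewrite andbF /= -[false%:R]/(0%:R); ring.
Qed.

(** The expectation is a polynomial in the step probabilities, with values of [f] as
    coefficients. *)
Lemma trig_walk (S : V -> V) st l (f : V -> R) Y :
  (forall i, trig (fun x => S x 0 i)) -> trig (fun x => walk (S x) st l f Y).
Proof.
move=> tS; elim: l Y => [|i l IH] Y /=; first exact: trig_cst.
apply: trig_add; apply: trig_mul => //.
have -> : (fun x => 1 - S x 0 i) = (fun x => 1 + -1 * S x 0 i).
  by apply/funext => x; rewrite mulN1r.
by apply: trig_add; [exact: trig_cst | exact: trig_scale].
Qed.

Lemma count_mem_flatten_enum (n : nat) (j : 'I_N) :
  count_mem j (flatten (nseq n (enum 'I_N))) = n.
Proof.
elim: n => //= n IH; rewrite count_cat IH.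
by rewrite count_uniq_mem ?enum_uniq // mem_enum.
Qed.

Lemma abs_sin_le (t : R) : `|sin t| <= `|t|.
Proof.
wlog t0 : t / 0 <= t.
  move=> H; have [/H//|/ltW t0] := leP 0 t.
  by have := H (- t); rewrite oppr_ge0 sinN !normrN; apply.
have [c _] := MVT_segment t0 (fun (t' : R) _ => is_derive_sin t')
  (continuous_subspaceT (@continuous_sin R)).
rewrite sin0 !subr0 => ->; rewrite normrM ler_piMl // ler_norml.
by rewrite cos_geN1 cos_le1.
Qed.

(* The variables are [sin (x_i - a_i)], so that the Bernstein polynomials are
   trigonometric and bounded by the same constant on the whole space. *)
Lemma trig_approximation (u : V -> R) (a : V) : continuous u ->
  exists M : R, forall err : R, 0 < err -> exists p, [/\ trig p,
    forall x, `|p x| <= M &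
    forall x, (forall i, `|x 0 i - a 0 i| <= 4^-1) -> `|u x - p x| <= err].
Proof.
move=> cu.
(* The level 1/2 keeps [asin] inside the interval where it is continuous, and is inactive for |x_i -
   a_i| <= 1/4. *)
pose clip (t : R) : R := Num.max (- 2^-1) (Num.min (2^-1) t).
have clipB t : - 2^-1 <= clip t <= 2^-1.
  rewrite /clip le_max lexx /= ge_max ge_min lexx andbT /=; lra.
pose G Y := u (a + \row_i asin (clip (Y 0 i))).
have asinI t : - (pi / 2) <= asin (clip t) <= pi / 2.
  have /andP[c1 c2] := clipB t.
  by rewrite asin_geNpi2 ?asin_lepi2 //; apply/andP; split; lra.
have [M HM] : exists M : R, forall Y, `|G Y| <= M.
  have K := @compact_ball_norm R N a 2.
  have cabs : continuous (fun x => `|u x|).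
    by move=> x; apply: (cvg_norm (cu x)).
  have Ka : [set x : V | `|x - a| <= 2] a by rewrite /= subrr normr0.
  have [c /set_mem _ cmax] := EVT_max_rV (ex_intro _ a Ka) K (continuous_subspaceT
    cabs).
  exists `|u c| => Y; apply: cmax; rewrite inE /= addrC addKr.
  apply: norm_le_coord => // i; rewrite mxE; apply: le_trans (ltW (pihalf_lt2 R)).
  by rewrite ler_norml asinI.
have cG : continuous G.
  move=> Y; apply/(@cvgrPdist_lt _ _ _ _ (nbhs_filter Y)) => e e0.
  set Z := a + \row_i asin (clip (Y 0 i)).
  have /continuousPnorm/(_ Z e e0)[r r0 Hr] := cu.
  have H i : \forall y \near Y, `|asin (clip ((y : V) 0 i)) - asin (clip (Y 0 i))| < r.
    have cc : {for Y, continuous (fun y : V => asin (clip (y 0 i)))}.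
      apply: (@continuous_comp _ _ _ (fun y : V => y 0 i) (fun t => asin (clip t)) Y).
        exact: coord_continuous.
      apply: (@continuous_comp _ _ _ clip (@asin R)); last first.
        by apply: continuous_asin; have := clipB (Y 0 i) => /andP[? ?]; apply/andP;
          split; lra.
      apply: continuous_max; first exact: cvg_cst.
      by apply: continuous_min; [exact: cvg_cst | exact: cvg_id].
    have /(@cvgrPdist_lt _ _ _ _ (nbhs_filter Y))/(_ r r0) := cc.
    by apply: filterS => y; rewrite distrC.
  have {}H : \forall y \near Y, forall i,
    `|asin (clip ((y : V) 0 i)) - asin (clip (Y 0 i))| < r.
    exact: (filter_forall (nbhs_filter Y) H).
  apply: filterS H => y Hy; rewrite distrC; apply: Hr.
  rewrite opprD addrACA subrr add0r.
  by apply: norm_lt_coord => // i; rewrite !mxE.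
have M0 : 0 <= M by exact: le_trans (HM 0).
exists M => err err0.
pose sv x : V := \row_i sin (x 0 i - a 0 i).
pose S x : V := \row_i (2^-1 * (1 + sin (x 0 i - a 0 i))).
have S01 x i : 0 <= S x 0 i <= 1.
  rewrite mxE; have := sin_geN1 (x 0 i - a 0 i); have := sin_le1 (x 0 i - a 0 i).
  by move=> ? ?; apply/andP; split; lra.
have tS i : trig (fun x => S x 0 i).
  have -> : (fun x => S x 0 i) = (fun x => 2^-1 * (1 + sin (x 0 i - a 0 i))).
    by apply/funext => x; rewrite mxE.
  by apply: trig_scale; apply: trig_add; [exact: trig_cst | exact: trig_sin_coord].
have [d d0 Hd] := uniformly_continuous_on_compact cG (@compact_ball_norm R N 0 1)
  (divr_gt0 err0 (ltr0Sn _ 1)).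
(* Chebyshev's argument: at distance at least [d] the trivial bound [2 M] on a difference of values
   of [G] is at most [C] times the squared distance. *)
pose C := 2 * M / d ^+ 2.
have C0 : 0 <= C by apply: divr_ge0; [exact: mulr_ge0 | exact: sqr_ge0].
(* Each coordinate of the walk will have variance [4 t (1 - t) / n <= 1 / n], so the [N] quadratic
   errors total at most [C N / n]. *)
have [n [n0 Hn]] : exists n : nat, (0 < n)%N /\ C * N%:R / n%:R <= err / 2.
  have err20 : 0 < err / 2 by rewrite divr_gt0.
  have X0 : 0 <= C * N%:R / (err / 2) by rewrite divr_ge0 ?(ltW err20) // mulr_ge0.
  exists (Num.bound (C * N%:R / (err / 2))).+1; split => //.
  have := archi_boundP X0; rewrite ltr_pdivrMr // => H.
  rewrite ler_pdivrMr ?ltr0n //; apply: le_trans (ltW H) _.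
  by rewrite mulrC ler_wpM2l ?(ltW err20) // ler_nat.
pose l := flatten (nseq n (enum 'I_N)).
(* Each coordinate starts at -1 and makes [n] steps of length [2 / n] with probability (1 + sin)/2,
   so its mean endpoint is sin (x_i - a_i). *)
pose p x := walk (S x) (2 / n%:R) l G (\row__ -1).
exists p; split.
- exact: trig_walk.
- move=> x; rewrite ler_norml; apply/andP; split.
    rewrite -(walk_cst (S x) (2 / n%:R) l (- M) (\row__ -1)); apply: walk_le => // y.
    by have := HM y; rewrite ler_norml => /andP[].
  rewrite -(walk_cst (S x) (2 / n%:R) l M (\row__ -1)); apply: walk_le => // y.
  by have := HM y; rewrite ler_norml => /andP[].
- move=> x xa.
  have sx i : `|sin (x 0 i - a 0 i)| <= 4^-1 by exact: le_trans (abs_sin_le _) (xa i).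
  have GE : G (sv x) = u x.
    congr u; apply/rowP => i; rewrite !mxE.
    have -> : clip (sin (x 0 i - a 0 i)) = sin (x 0 i - a 0 i).
      have := sx i; rewrite ler_norml => /andP[s1 s2].
      rewrite /clip min_r; last lra.
      by rewrite max_r //; lra.
    rewrite sinK ?subrKC // in_itv /=.
    have := xa i; have := pihalf_ge1 R; rewrite ler_norml => p1 /andP[h1 h2].
    by apply/andP; split; lra.
  have Gdiff Y : `|G (sv x) - G Y| <= err / 2 + \sum_j C * (Y 0 j - sv x 0 j) ^+ 2.
    have sum0 : 0 <= \sum_j C * (Y 0 j - sv x 0 j) ^+ 2.
      by apply: sumr_ge0 => j _; rewrite mulr_ge0 // sqr_ge0.
    have [close|far] := ltP `|Y - sv x| d.
      rewrite distrC; apply: le_trans (ltW (Hd (sv x) Y _ close)) _;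
        last by rewrite lerDl.
      rewrite /= subr0; apply: norm_le_coord => // i.
      by rewrite mxE; apply: le_trans (sx i) _; lra.
    apply: le_trans (ler_normB _ _) _.
    apply: le_trans (lerD (HM _) (HM _)) _.
    apply: (@le_trans _ _ (C * d ^+ 2)).
      by rewrite /C divfK ?gt_eqF ?exprn_gt0 // le_eqVlt; apply/orP; left; apply/eqP;
        ring.
    rewrite -mulr_sumr; apply: ler_wpDl; first by rewrite divr_ge0 // ltW.
    apply: ler_wpM2l => //.
    apply: (@le_trans _ _ (`|Y - sv x| ^+ 2)).
      by rewrite lerXn2r // nnegrE ?normr_ge0 // ltW.
    apply: le_trans (norm_dotv _) _.
    apply: ler_sum => j _; rewrite -expr2.
    by have -> : (Y - sv x) 0 j = Y 0 j - sv x 0 j by rewrite !mxE.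
  have W : walk (S x) (2 / n%:R) l (fun Y =>
    err / 2 + \sum_j C * (Y 0 j - sv x 0 j) ^+ 2) (\row__ -1) <= err.
    rewrite walkD walk_cst walk_sum.
    have : \sum_j walk (S x) (2 / n%:R) l (fun Y =>
      C * (Y 0 j - sv x 0 j) ^+ 2) (\row__ -1) <= err / 2.
      apply: le_trans Hn.
      have -> : C * N%:R / n%:R = \sum_(j < N) C / n%:R.
        by rewrite sumr_const card_ord -[RHS]mulr_natl; ring.
      apply: ler_sum => j _; rewrite walkZ; apply: ler_wpM2l => //.
      rewrite walk_second_moment count_mem_flatten_enum.
      have nn0 : n%:R != 0 :> R by rewrite pnatr_eq0 -lt0n.
      set t := S x 0 j.
      have -> : (\row__ -1 : V) 0 j + n%:R * (2 / n%:R) * t - sv x 0 j = 0.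
        by rewrite /t !mxE; field.
      have /andP[t0 t1] := S01 x j.
      have -> : 0 ^+ 2 + n%:R * (2 / n%:R) ^+ 2 * t * (1 - t) =
        4 * t * (1 - t) / n%:R by field.
      rewrite ler_pdivrMr ?ltr0n // mulVf //.
      have := sqr_ge0 (2 * t - 1); rewrite -/t; lra.
    lra.
  rewrite -GE.
  have diffE : G (sv x) - p x = walk (S x) (2 / n%:R) l (fun Y =>
    G (sv x) + -1 * G Y) (\row__ -1).
    by rewrite walkD walk_cst walkZ mulN1r.
  rewrite ler_norml; apply/andP; split.
    rewrite -lerN2 opprK; apply: le_trans W.
    rewrite diffE -[leLHS]mulN1r -walkZ; apply: walk_le => // Y.
    have := Gdiff Y; rewrite ler_norml => /andP[H _]; lra.
  apply: le_trans W.
  rewrite diffE; apply: walk_le => // Y.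
  have := Gdiff Y; rewrite ler_norml => /andP[_ H]; lra.
Qed.

End TrigApproximation.

(** * Steklov averages *)

Section Steklov.
Variables (R : realType) (N : nat).
Local Notation V := 'rV[R]_N.
Local Notation mu := (@lebesgue_measure R).
Implicit Types (k F : R -> R) (g h : V -> R) (x y v : V) (l : seq 'I_N).

(* Based at -2, so that [0, 1] lies in the interior of the domain of integration. *)
Let prim k (t : R) : R := \int[mu]_(s in `[(- 2), t]) k s.

Lemma is_derive_prim k (t : R) : continuous k -> - 2 < t < 2 ->
  is_derive t 1 (prim k) (k t).
Proof.
move=> ck /andP[t1 t2].
have ik : mu.-integrable `[(- 2), 2] (EFin \o k).
  by apply: continuous_compact_integrable;
    [exact: segment_compact | exact: continuous_subspaceT].
have [d e] := continuous_FTC1_closed t2 ik t1 (ck t).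
by split; [exact: d | rewrite -derive1E].
Qed.

Definition mean (d : R) k : R := d^-1 * (prim k d - prim k 0).

Section Mean.
Variable d : R.
Hypothesis d01 : 0 < d <= 1.

(** Any primitive computes the mean, which reduces the algebra of means to rules for derivatives. *)
Lemma mean_primitive k F : continuous k ->
  (forall t : R, 0 <= t <= d -> is_derive t 1 F (k t)) -> mean d k = d^-1 * (F d - F 0).
Proof.
move=> ck DF; rewrite /mean; congr (_ * _).
have /andP[d0 d1] := d01.
have D (t : R) : 0 <= t <= d -> is_derive t 1 (prim k - F) 0.
  move=> td; rewrite -(subrr (k t)); apply: is_deriveB; last exact: DF.
  by apply: is_derive_prim => //; have /andP[? ?] := td; apply/andP; split; lra.
have D' (t : R) : t \in `]0, d[ -> is_derive t 1 (prim k - F) ((fun=> 0) t).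
  by rewrite in_itv /= => /andP[t0 td]; apply: D; rewrite !ltW.
have [|c _] := MVT_segment (ltW d0) D'.
  apply: derivable_within_continuous => t; rewrite in_itv /= => td.
  by case: (D t td).
rewrite mul0r /= => /eqP; rewrite subr_eq0 => /eqP.
rewrite -[LHS]/(prim k d - F d) -[RHS]/(prim k 0 - F 0).
by lra.
Qed.

Lemma mean_le k1 k2 : continuous k1 -> continuous k2 ->
  (forall t, 0 <= t <= d -> k1 t <= k2 t) -> mean d k1 <= mean d k2.
Proof.
move=> c1 c2 k12; have /andP[d0 d1] := d01.
rewrite /mean ler_pM2l ?invr_gt0 // -subr_ge0.
have D (t : R) : 0 <= t <= d -> is_derive t 1 (prim k2 - prim k1) (k2 t - k1 t).
  by move=> /andP[? ?]; apply: is_deriveB; apply: is_derive_prim => //; apply/andP;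
    split; lra.
have D' (t : R) : t \in `]0, d[ -> is_derive t 1 (prim k2 - prim k1) ((fun t =>
  k2 t - k1 t) t).
  by rewrite in_itv /= => /andP[t0 td]; apply: D; rewrite !ltW.
have [|c cI] := MVT_segment (ltW d0) D'.
  apply: derivable_within_continuous => t; rewrite in_itv /= => td.
  by case: (D t td).
rewrite -[X in X = _ -> _]/((prim k2 d - prim k1 d) - (prim k2 0 - prim k1 0)) => E.
have -> : prim k2 d - prim k2 0 - (prim k1 d - prim k1 0) =
   prim k2 d - prim k1 d - (prim k2 0 - prim k1 0) by lra.
rewrite E mulr_ge0 //; last by rewrite subr0 ltW.
by rewrite subr_ge0 k12 //; move: cI; rewrite in_itv.
Qed.

Lemma mean_cst (c : R) : mean d (fun _ => c) = c.
Proof.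
have /andP[d0 d1] := d01.
have D (t : R) : 0 <= t <= d -> is_derive t 1 (fun t : R => 0 * t ^+ 2 + c * t + 0) c.
  by move=> _; have := is_derive_quadratic 0 c 0 t; rewrite mulr0 mul0r add0r.
rewrite (mean_primitive (@cst_continuous _ _ c) D).
by field; rewrite gt_eqF.
Qed.

Lemma mean_linear (a : R) k1 k2 : continuous k1 -> continuous k2 ->
  mean d (fun t => a * k1 t + k2 t) = a * mean d k1 + mean d k2.
Proof.
move=> c1 c2; have /andP[d0 d1] := d01.
have D (t : R) : 0 <= t <= d -> is_derive t 1 (a *: prim k1 + prim k2) (a * k1 t +
  k2 t).
  move=> /andP[? ?]; apply: (is_deriveD (is_deriveZ a _)); apply: is_derive_prim => //;
    by apply/andP; split; lra.
have cc : continuous (fun t => a * k1 t + k2 t).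
  by move=> t; exact: (cvgD (cvgM (cvg_cst a) (c1 t)) (c2 t)).
rewrite (mean_primitive cc D) /mean.
by rewrite -[X in _ * X = _]/((a * prim k1 d + prim k2 d) - (a * prim k1 0 +
  prim k2 0)); ring.
Qed.

Definition steklov i g x : R := mean d (fun s => g (x + s *: basis_vec R i)).

Lemma continuous_on_line g x v : continuous g -> continuous (fun s : R =>
  g (x + s *: v)).
Proof. by move=> cg s; apply: continuous_comp;
  [exact: continuous_line | exact: cg]. Qed.

Lemma norm_basis_le (i : 'I_N) : `|basis_vec R i| <= 1.
Proof.
apply: norm_le_coord => // j; rewrite mxE.
by case: (_ && _); rewrite ?normr1 ?normr0.
Qed.

Lemma steklov_le i g h x : continuous g -> continuous h ->
  (forall y, `|y - x| <= d -> g y <= h y) -> steklov i g x <= steklov i h x.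
Proof.
move=> cg ch gh; apply: mean_le; [exact: continuous_on_line..|].
move=> t /andP[t0 td]; apply: gh; rewrite addrC addKr normrZ ger0_norm //.
apply: le_trans td; rewrite ler_piMr //; exact: norm_basis_le.
Qed.

Lemma steklov_linear i a g h x : continuous g -> continuous h ->
  steklov i (fun y => a * g y + h y) x = a * steklov i g x + steklov i h x.
Proof. by move=> cg ch; apply: mean_linear; exact: continuous_on_line. Qed.

Lemma steklov_cst i c x : steklov i (fun _ => c) x = c.
Proof. exact: mean_cst. Qed.

Lemma steklov_shift i g x v : steklov i (fun y => g (y + v)) x = steklov i g (x + v).
Proof. by congr mean; apply/funext => s; rewrite addrAC. Qed.

Lemma steklov_dist i g h x (e : R) : continuous g -> continuous h ->
  (forall y, `|y - x| <= d -> `|g y - h y| <= e) ->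
    `|steklov i g x - steklov i h x| <= e.
Proof.
move=> cg ch gh.
have gB : continuous (fun y => -1 * h y + g y).
  by move=> y; exact: (cvgD (cvgM (cvg_cst _) (ch y)) (cg y)).
have -> : steklov i g x - steklov i h x = steklov i (fun y => -1 * h y + g y) x.
  by rewrite steklov_linear // mulN1r addrC.
rewrite ler_norml; apply/andP; split.
  rewrite -[leLHS](steklov_cst i (- e) x); apply: steklov_le => //;
    first exact: cst_continuous.
  by move=> y /gh; rewrite ler_norml => /andP[? ?]; lra.
rewrite -[leRHS](steklov_cst i e x); apply: steklov_le => //;
  first exact: cst_continuous.
by move=> y /gh; rewrite ler_norml => /andP[? ?]; lra.
Qed.

Lemma continuous_shift g v : continuous g -> continuous (fun y => g (y + v)).
Proof.
move=> /continuousPnorm cg; apply/continuousPnorm => x e e0.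
have [r r0 H] := cg (x + v) e e0; exists r => // y yx; apply: H.
by rewrite opprD addrACA subrr addr0.
Qed.

Lemma continuous_steklov i g : continuous g -> continuous (steklov i g).
Proof.
move=> cg; apply/continuousPnorm => x e e0.
have e20 : 0 < e / 2 by rewrite divr_gt0.
have [r r0 H] := uniformly_continuous_on_compact cg (@compact_ball_norm R N x d) e20.
exists r => // y yx; apply: (@le_lt_trans _ _ (e / 2)); last by lra.
have -> : steklov i g y = steklov i (fun z => g (z + (y - x))) x.
  by rewrite steklov_shift subrKC.
apply: steklov_dist => //; first exact: continuous_shift.
by move=> z /(H _ (z + (y - x))); rewrite addrC addKr => /(_ yx)/ltW.
Qed.

Definition diff_quot i g x : R := d^-1 * (g (x + d *: basis_vec R i) - g x).

(** At [x + t e_i] the average is the increment from [t] to [t + d] of one fixed primitive along the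
    line, so continuity of [g] is enough to differentiate it. *)
Lemma is_derive_steklov_self i g x : continuous g ->
  is_derive x (basis_vec R i) (steklov i g) (diff_quot i g x).
Proof.
move=> cg; apply/is_derive_line; have /andP[d0 d1] := d01.
pose k (s : R) := g (x + s *: basis_vec R i).
have ck : continuous k by exact: continuous_on_line.
pose Phi (t : R) := d^-1 * (prim k (t + d) - prim k t).
have sh (c t : R) : - 2 < t + c < 2 -> is_derive t 1 (fun t =>
  prim k (t + c)) (k (t + c)).
  move=> H; rewrite -[k (t + c)]mulr1.
  apply: (@is_derive1_comp R (prim k) (fun t => t + c)); first exact: is_derive_prim.
  rewrite -[X in is_derive _ _ _ X]addr0; apply: is_deriveD.
apply: (@near_eq_is_derive _ _ _ Phi).
  near=> t.
  have tI : - 1 < t < 1 by apply/andP; split; near: t;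
    [exact: lt_nbhsr | exact: lt_nbhsl].
  have /andP[t1 t2] := tI.
  have D (s : R) : 0 <= s <= d -> is_derive s 1 (fun s => prim k (s + t))
      (g (x + t *: basis_vec R i + s *: basis_vec R i)).
    move=> /andP[s0 s1].
    have -> : x + t *: basis_vec R i + s *: basis_vec R i =
      x + (s + t) *: basis_vec R i.
      by rewrite scalerDl addrA addrAC.
    by apply: sh; apply/andP; split; lra.
  rewrite /steklov (mean_primitive (@continuous_on_line _ _ _ cg) D).
  by rewrite add0r [d + t]addrC.
have -> : diff_quot i g x = d^-1 * (k (0 + d) - k (0 + 0)).
  by rewrite /diff_quot /k !addr0 add0r scale0r addr0.
have D0 : is_derive (0 : R) 1 (fun t => prim k (t + d)) (k (0 + d)).
  by apply: sh; apply/andP; split; lra.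
have D1 : is_derive (0 : R) 1 (prim k) (k (0 + 0)).
  by rewrite addr0; apply: is_derive_prim => //; apply/andP; split; lra.
have -> : Phi = d^-1 *: ((fun t => prim k (t + d)) - prim k) by [].
exact: (is_deriveZ d^-1 (is_deriveB D0 D1)).
Unshelve. all: by end_near. Qed.

(** Uniformity in [y] is what allows the first-order error to be averaged. *)
Lemma first_order_uniform g (gv : V -> R) v x (c e : R) : 0 < e ->
  (forall y, is_derive y v g (gv y)) -> continuous gv ->
  exists2 r : R, 0 < r & forall y t, `|y - x| <= c -> `|t| < r ->
    `|g (y + t *: v) - g y - t * gv y| <= e * `|t|.
Proof.
move=> e0 Dg cgv.
have [r r0 H] := uniformly_continuous_on_compact cgv (@compact_ball_norm R N x c) e0.
have v1 : 0 < `|v| + 1 by rewrite ltr_wpDl.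
exists (r / (`|v| + 1)); first by rewrite divr_gt0.
move=> y t yx; rewrite ltr_pdivlMr // => tr.
pose k (s : R) := g (y + s *: v).
have Dk (s : R) : is_derive s 1 k (gv (y + s *: v)) by apply: is_derive_line_at.
have ck : continuous k.
  by move=> s; apply/differentiable_continuous/derivable1_diffP; case: (Dk s).
have [s sI ks] : exists2 s : R, `|s| <= `|t| & k t - k 0 = gv (y + s *: v) * t.
  have [ta|ta] := leP 0 t.
    have [s] := MVT_segment ta (fun s _ => Dk s) (continuous_subspaceT ck).
    rewrite in_itv /= subr0 => /andP[c0 c1] ->; exists s => //.
    by rewrite !ger0_norm.
  have [s] := MVT_segment (ltW ta) (fun s _ => Dk s) (continuous_subspaceT ck).
  rewrite in_itv /= sub0r => /andP[c0 c1] E; exists s.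
    by rewrite !ler0_norm ?lerN2 // ltW.
  by rewrite -opprB E mulrN opprK.
have -> : g (y + t *: v) - g y - t * gv y = (gv (y + s *: v) - gv y) * t.
  by move: ks; rewrite /k scale0r addr0 => ->; ring.
rewrite normrM ler_wpM2r //; apply/ltW/H => //.
rewrite addrC addKr normrZ; apply: le_lt_trans tr.
by apply: ler_pM => //; rewrite lerDl.
Qed.

Lemma is_derive_steklov i g (gv : V -> R) v x : continuous g ->
  (forall y, is_derive y v g (gv y)) -> continuous gv ->
  is_derive x v (steklov i g) (steklov i gv x).
Proof.
move=> cg Dg cgv; apply/is_deriveP => e e0.
have [r r0 H] := first_order_uniform x d e0 Dg cgv.
exists r => // t _ tr.
have cs : continuous (fun y => g (y + t *: v)) by exact: continuous_shift.
have cB : continuous (fun y => -1 * g y + g (y + t *: v)).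
  by move=> y; exact: (cvgD (cvgM (cvg_cst _) (cg y)) (cs y)).
have cB' : continuous (fun y => t * gv y + 0).
  by move=> y; exact: (cvgD (cvgM (cvg_cst _) (cgv y)) (cvg_cst _)).
have -> : steklov i g (x + t *: v) - steklov i g x - t * steklov i gv x =
    steklov i (fun y => -1 * g y + g (y + t *: v)) x - steklov i (fun y =>
      t * gv y + 0) x.
  rewrite !steklov_linear //; last exact: cst_continuous.
  by rewrite steklov_cst steklov_shift; ring.
apply: steklov_dist => // y yx.
have -> : -1 * g y + g (y + t *: v) - (t * gv y + 0) =
  g (y + t *: v) - g y - t * gv y by ring.
exact: H.
Qed.

Definition steklovs l g : V -> R := foldr steklov g l.

Lemma continuous_steklovs l g : continuous g -> continuous (steklovs l g).
Proof. by move=> cg; elim: l => //= i l IH; exact: continuous_steklov. Qed.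

Lemma steklovs_le l g h x : continuous g -> continuous h ->
  (forall y, `|y - x| <= d * (size l)%:R -> g y <= h y) ->
  steklovs l g x <= steklovs l h x.
Proof.
move=> cg ch; elim: l x => [|i l IH] x H /=.
  by apply: H; rewrite subrr normr0 mulr0.
apply: steklov_le; [exact: continuous_steklovs..|].
move=> y yx; apply: IH => z zy; apply: H.
have -> : z - x = (z - y) + (y - x) by rewrite addrA subrK.
apply: le_trans (ler_normD _ _) _; rewrite /= -natr1 mulrDr mulr1.
exact: lerD.
Qed.

Lemma steklovs_linear l a g h x : continuous g -> continuous h ->
  steklovs l (fun y => a * g y + h y) x = a * steklovs l g x + steklovs l h x.
Proof.
move=> cg ch; elim: l x => [|i l IH] x //=.
rewrite (_ : steklovs l _ = fun y => a * steklovs l g y + steklovs l h y);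
  last exact/funext.
by rewrite steklov_linear; [|exact: continuous_steklovs..].
Qed.

Lemma steklovs_cst l c x : steklovs l (fun _ => c) x = c.
Proof.
elim: l x => [|i l IH] x //=.
rewrite (_ : steklovs l _ = fun=> c); last exact/funext.
exact: steklov_cst.
Qed.

Lemma steklovs_shift l g x v : steklovs l (fun y => g (y + v)) x = steklovs l g (x + v).
Proof.
elim: l x => [|i l IH] x //=.
rewrite (_ : steklovs l _ = fun y => steklovs l g (y + v)); last exact/funext.
exact: steklov_shift.
Qed.

Lemma steklovs_dist l g h x (e : R) : continuous g -> continuous h ->
  (forall y, `|y - x| <= d * (size l)%:R -> `|g y - h y| <= e) ->
  `|steklovs l g x - steklovs l h x| <= e.
Proof.
move=> cg ch; elim: l x => [|i l IH] x H /=.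
  by apply: H; rewrite subrr normr0 mulr0.
apply: steklov_dist; [exact: continuous_steklovs..|].
move=> y yx; apply: IH => z zy; apply: H.
have -> : z - x = (z - y) + (y - x) by rewrite addrA subrK.
apply: le_trans (ler_normD _ _) _; rewrite /= -natr1 mulrDr mulr1.
exact: lerD.
Qed.

Lemma is_derive_steklovs l g (gv : V -> R) v x : continuous g ->
  (forall y, is_derive y v g (gv y)) -> continuous gv ->
  is_derive x v (steklovs l g) (steklovs l gv x).
Proof.
move=> cg Dg cgv; elim: l x => [|i l IH] x //=.
exact: (is_derive_steklov i x (continuous_steklovs cg) IH (continuous_steklovs cgv)).
Qed.

Lemma continuous_diff_quot i g : continuous g -> continuous (diff_quot i g).
Proof.
have cs v : continuous g -> continuous (fun y => g (y + v)) by exact: continuous_shift.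
move=> cg x; exact: (cvgM (cvg_cst d^-1) (cvgB (cs _ cg x) (cg x))).
Qed.

(** The outer averages commute with the derivative until it meets the one in direction [i], which it
    turns into a difference quotient; that quotient then passes through the inner averages. *)
Lemma is_derive_steklovs_mem l i g x : continuous g -> i \in l ->
  is_derive x (basis_vec R i) (steklovs l g) (steklovs (rem i l) (diff_quot i g) x).
Proof.
move=> cg; elim: l x => [|k l IH] x //=; rewrite inE; have [->|ki /=] := eqVneq i k.
  move=> _ /=.
  have -> : steklovs l (diff_quot k g) x = diff_quot k (steklovs l g) x.
    rewrite /diff_quot -steklovs_shift.
    have -> : (fun y => d^-1 * (g (y + d *: basis_vec R k) - g y)) =
        (fun y => d^-1 * (fun z => -1 * g z + g (z + d *: basis_vec R k)) y + 0).
      by apply/funext => y; ring.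
    rewrite steklovs_linear; last exact: cst_continuous.
      rewrite steklovs_linear //; last exact: continuous_shift.
      by rewrite steklovs_cst; ring.
    have cs v : continuous (fun y => g (y + v)) by exact: continuous_shift.
    by move=> y; exact: (cvgD (cvgM (cvg_cst _) (cg y)) (cs _ y)).
  by apply: is_derive_steklov_self; exact: continuous_steklovs.
move=> il.
apply: (is_derive_steklov k x (continuous_steklovs cg) (fun y => IH y il)).
by apply: continuous_steklovs; exact: continuous_diff_quot.
Qed.

Let twice := enum 'I_N ++ enum 'I_N.

(* Each averaging gains one derivative in its own direction. *)
Lemma C2_steklovs g : continuous g -> C2 (steklovs twice g).
Proof.
move=> cg.
have m1 i : i \in twice by rewrite mem_cat mem_enum.
(* Every index occurs twice in [twice], so even for [i = j] an averaging remains for the second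
   derivative. *)
have m2 i j : j \in rem i twice.
  have : (0 < count_mem j (rem i twice))%N.
    rewrite count_rem m1 count_cat !count_uniq_mem ?enum_uniq // !mem_enum /=.
    by case: (i == j).
  by rewrite -has_count has_pred1.
apply: (@C2I _ _ _ (fun i => steklovs (rem i twice) (diff_quot i g))
  (fun i j => steklovs (rem j (rem i twice)) (diff_quot j (diff_quot i g)))).
- exact: continuous_steklovs.
- by move=> i x; exact: is_derive_steklovs_mem.
- by move=> i; apply: continuous_steklovs; exact: continuous_diff_quot.
- by move=> i j x; apply: is_derive_steklovs_mem => //; exact: continuous_diff_quot.
- by move=> i j; apply: continuous_steklovs; do 2 apply: continuous_diff_quot.
Qed.

Lemma continuous_lap (A : 'M[R]_N) h : C2 h -> continuous (lap A h).
Proof.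
move=> /C2_grad[ch Dh c1 D2 c2].
have -> : lap A h = fun x => \sum_i \sum_j A i j * partial (partial h i) j x.
  apply/funext => x; rewrite lapE /mxtrace; apply: eq_bigr => i _; rewrite mxE.
  by apply: eq_bigr => j _; rewrite mxE.
apply: continuous_sumf => i; apply: continuous_sumf => j x.
exact: (cvgM (cvg_cst _) (c2 i j x)).
Qed.

Lemma steklovs_C2_lap l (A : 'M[R]_N) h : C2 h ->
  C2 (steklovs l h) /\ forall x, lap A (steklovs l h) x = steklovs l (lap A h) x.
Proof.
move=> /C2_grad[ch Dh c1 D2 c2].
have D1' : has_grad (steklovs l h) (fun i => steklovs l (partial h i)).
  by move=> i x; apply: is_derive_steklovs.
have D2' i : has_grad (steklovs l (partial h i)) (fun j =>
  steklovs l (partial (partial h i) j)).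
  by move=> j x; exact: (is_derive_steklovs l x (c1 i) (D2 i j) (c2 i j)).
split.
  by apply: (C2I _ D1' _ D2') => [|i|i j]; exact: continuous_steklovs.
have Slin (I : Type) (s : seq I) (a : I -> R) (f : I -> V ->
  R) x : (forall i, continuous (f i)) ->
    steklovs l (fun y => \sum_(i <- s) a i * f i y) x =
      \sum_(i <- s) a i * steklovs l (f i) x.
  move=> cf; elim: s => [|i s IH].
    rewrite big_nil -[RHS](steklovs_cst l 0 x); congr steklovs.
    by apply/funext => y; rewrite big_nil.
  have -> : (fun y => \sum_(j <- i :: s) a j * f j y) =
      (fun y => a i * f i y + (fun z => \sum_(j <- s) a j * f j z) y).
    by apply/funext => y; rewrite big_cons.
  rewrite big_cons -IH steklovs_linear //.
  by apply: continuous_sumf => j y; exact: (cvgM (cvg_cst _) (cf j y)).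
move=> x.
have -> : lap A h = fun x => \sum_i 1 * (fun y =>
  \sum_j A i j * partial (partial h i) j y) x.
  apply/funext => y; rewrite lapE /mxtrace; apply: eq_bigr => i _; rewrite mxE mul1r.
  by apply: eq_bigr => j _; rewrite mxE.
rewrite Slin; last first.
  by move=> i; apply: continuous_sumf => j y; exact: (cvgM (cvg_cst _) (c2 i j y)).
rewrite lapE (hessianE _ D1' D2') /mxtrace; apply: eq_bigr => i _.
rewrite mxE mul1r Slin //.
by apply: eq_bigr => j _; rewrite mxE.
Qed.

End Mean.
End Steklov.

(** * Smoothing of viscosity subsolutions *)

Section Smoothing.
Variables (R : realType) (N : nat) (lam Lam : R).
Hypotheses (lam0 : 0 < lam) (lamLam : lam <= Lam).
Local Notation V := 'rV[R]_N.
Implicit Types (x y z : V) (A : 'M[R]_N) (u f : V -> R).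

Lemma lin_sub_at_le A u F G x : F <= G -> lin_sub_at A u F x -> lin_sub_at A u G x.
Proof. by move=> FG H phi Cphi Hphi; apply: le_trans FG; exact: H. Qed.

(** Division by [t] and passage to the limit [t --> 0]; the coefficient [C] must not depend on
    [t]. *)
Lemma le0_of_quadratic (a C : R) : 0 <= C -> (forall t : R, 0 < t <= 1 ->
  0 <= t * a + C * t ^+ 2) -> 0 <= a.
Proof.
move=> C0 H; rewrite leNgt; apply/negP => a0.
pose t := Num.min 1 (- a / (2 * (C + 1))).
have C1 : 0 < 2 * (C + 1) by lra.
have t0 : 0 < t by rewrite lt_min ltr01 divr_gt0 // oppr_gt0.
have t1 : t <= 1 by rewrite ge_min lexx.
have := H t; rewrite t0 t1 => /(_ isT).
have -> : t * a + C * t ^+ 2 = t * (a + C * t) by ring.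
rewrite pmulr_rge0 // leNgt => /negP; apply.
have : t <= - a / (2 * (C + 1)) by rewrite ge_min lexx orbT.
rewrite ler_pdivlMr // => H2.
have : C * t <= (C + 1) * t by apply: ler_wpM2r; lra.
lra.
Qed.

(* The resolvent [h] of a trigonometric approximation
   of [u] satisfies [u <= h + tau F + O(tau^2)] near [x0]; averaging this
   inequality and comparing the averaged resolvent with the averaged [u] gives
   [0 <= tau (F + sup lap w) + O(tau^2)]. *)
Lemma steklov_lin_sub u x0 (F r d : R) A (l := enum 'I_N ++ enum 'I_N) :
  ellipticity_set lam Lam A -> continuous u -> 0 < r -> 2 * r <= 4^-1 ->
  0 < d <= 1 -> d * (size l)%:R <= r ->
  (forall z, `|z - x0| <= 2 * r -> lin_sub_at A u F z) ->
  - lap A (steklovs d l u) x0 <= F.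
Proof.
move=> eA cu r0 r4 d01 dl usub.
set w := steklovs d l u.
have Cw : C2 w by exact: C2_steklovs.
apply/ler_addgt0Pr => e e0.
(* An upper bound for [lap A w] near [x0], so that [- w] is there a classical subsolution with
   constant right-hand side [G]. *)
pose G := lap A w x0 + e.
have [r1 r10 [r1r Hr1]] : exists2 r1 : R, 0 < r1 & r1 <= r /\
    forall z, dotv (z - x0) (z - x0) < r1 ^+ 2 -> lap A w z <= G.
  have /continuousPnorm/(_ x0 e e0)[r1 r10 H] := @continuous_lap R N A _ Cw.
  exists (Num.min (r1 / 2) r); first by rewrite lt_min r0 divr_gt0.
  split; first by rewrite ge_min lexx orbT.
  move=> z zx; have m0 : 0 <= Num.min (r1 / 2) r by rewrite le_min ltW ?divr_gt0 // ltW.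
  have := norm_le_dotv m0 (ltW zx); rewrite le_min => /andP[zr _].
  have : `|lap A w z - lap A w x0| < e by apply: H; lra.
  by rewrite ltr_norml /G => /andP[_ ?]; lra.
suff : 0 <= F + G by rewrite /G; lra.
have [M HM] := trig_approximation x0 cu.
pose c' := 2 * N%:R * Lam * (4 * N%:R * Lam + 8 * Lam).
have Lam0 : 0 < Lam by exact: lt_le_trans lamLam.
have c'0 : 0 <= c' by rewrite /c' !mulr_ge0 ?addr_ge0 ?mulr_ge0 // ltW.
have M0 : 0 <= M.
  by have [p [_ /(_ 0) pM _]] := HM 1 ltr01; apply: le_trans pM.
(* [M] is independent of the accuracy of the approximation, so both barrier constants are fixed
   before [tau]. *)
pose K1 := (2 * M + 2 + `|F|) / r ^+ 4.
pose K2 := (2 * M + 2 + `|G|) / r1 ^+ 4.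
have r40 : 0 < r ^+ 4 by rewrite exprn_gt0.
have r140 : 0 < r1 ^+ 4 by rewrite exprn_gt0.
have K10 : 0 <= K1 by apply: divr_ge0; [have := normr_ge0 F; lra | exact: ltW].
have K20 : 0 <= K2 by apply: divr_ge0; [have := normr_ge0 G; lra | exact: ltW].
apply: (@le0_of_quadratic _ (2 + (K1 + K2) * c')).
  by rewrite addr_ge0 // mulr_ge0 // addr_ge0.
move=> tau /andP[tau0 tau1].
have taF : - `|F| <= tau * F.
  have : `|tau * F| <= `|F| by rewrite normrM ler_piMl // gtr0_norm.
  by rewrite ler_norml => /andP[].
have taG : - `|G| <= tau * G.
  have : `|tau * G| <= `|G| by rewrite normrM ler_piMl // gtr0_norm.
  by rewrite ler_norml => /andP[].
have err0 : 0 < tau ^+ 2 by rewrite exprn_gt0.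
have err1 : tau ^+ 2 <= 1 by rewrite expr_le1 // ltW.
have [p [tp pM pu]] := HM _ err0.
have {}pu x : `|x - x0| <= 2 * r -> `|u x - p x| <= tau ^+ 2.
  move=> H; apply: pu => i; have := coord_norm (x - x0) i; rewrite !mxE => H2.
  by apply: le_trans H2 _; apply: le_trans H _.
have uM x : `|x - x0| <= 2 * r -> `|u x| <= M + tau ^+ 2.
  move=> H; rewrite -[u x](subrK (p x)) addrC; apply: le_trans (ler_normD _ _) _.
  by apply: lerD; [exact: pM | exact: pu].
have [h th hp] := trig_resolvent (elliptic_ge0 lam0 eA) (ltW tau0) tp.
have Ch := trig_C2 th.
(* A trigonometric sum has some bound [B], possibly depending on [tau]; the maximum principle
   improves it to [M]. *)
have hM x : `|h x| <= M.
  have [B HB] := trig_bounded th.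
  rewrite ler_norml; apply/andP; split; last first.
    apply: (@resolvent_bound _ _ _ _ lam0 lamLam A h p tau M B eA (ltW tau0) Ch hp)
      => y.
      by have := pM y; rewrite ler_norml => /andP[].
    by have := HB y; rewrite ler_norml => /andP[].
  rewrite -lerN2 opprK -mulN1r.
  apply: (@resolvent_bound _ _ _ _ lam0 lamLam A (fun x => -1 * h x) (fun x =>
    -1 * p x) tau M B eA (ltW tau0) (C2Z _ Ch)).
  - by move=> y; rewrite lapZ // -hp; ring.
  - by move=> y; rewrite mulN1r lerNl; have := pM y; rewrite ler_norml => /andP[].
  - by move=> y; rewrite mulN1r lerNl; have := HB y; rewrite ler_norml => /andP[].
have cp : continuous p by case: (trig_C2 tp).
have ch : continuous h by case: Ch.
(* The iterated average at [x0] only sees points [y] within [r], and a comparison ball of radius [r]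
   around such a [y] stays within [2 r], where [p] approximates [u]. *)
have step1 y : `|y - x0| <= r -> u y - h y <= tau ^+ 2 + tau * F + K1 * c' * tau ^+ 2.
  move=> yx.
  have close x : dotv (x - y) (x - y) <= r ^+ 2 -> `|x - x0| <= 2 * r.
    move=> /(norm_le_dotv (ltW r0)) xy.
    have -> : x - x0 = (x - y) + (y - x0) by rewrite addrA subrK.
    by apply: le_trans (ler_normD _ _) _; lra.
  apply: (@resolvent_comparison _ _ _ _ lam0 lamLam A u h p y r tau F _ (2 * M +
    tau ^+ 2) K1 eA r0 (ltW tau0) K10 cu Ch hp).
  - by move=> x /ltW /close; exact: usub.
  - by move=> x /close /pu; rewrite ler_norml => /andP[].
  - move=> x /close /uM; rewrite ler_norml => /andP[_ H1].
    by have := hM x; rewrite ler_norml => /andP[H2 _]; lra.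
  - by rewrite /K1 divfK ?gt_eqF //; lra.
have step2 : w x0 <= steklovs d l h x0 + (tau ^+ 2 + tau * F + K1 * c' * tau ^+ 2).
  rewrite -[steklovs d l h x0]mul1r -[X in _ + X](steklovs_cst d01 l _ x0).
  rewrite -(steklovs_linear d01) //; last exact: cst_continuous.
  apply: (steklovs_le d01) => //.
    by move=> y; exact: (cvgD (cvgM (cvg_cst _) (ch y)) (cvg_cst _)).
  by move=> y yx; have := step1 y (le_trans yx dl); lra.
have [Csh lapsh] := steklovs_C2_lap d01 l A Ch.
have clh := @continuous_lap R N A _ Ch.
have sub_near x : dotv (x - x0) (x - x0) <= r1 ^+ 2 ->
  forall y, `|y - x| <= d * (size l)%:R -> `|y - x0| <= 2 * r.
  move=> /(norm_le_dotv (ltW r10)) xx0 y yx.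
  have -> : y - x0 = (y - x) + (x - x0) by rewrite addrA subrK.
  by apply: le_trans (ler_normD _ _) _; lra.
(* The reverse comparison for the averages: [lap A] commutes with them, so the average of [h] solves
   the resolvent equation with the average of [p] as datum. Adding [step2] cancels both unknown
   values at [x0]. *)
have step3 : -1 * w x0 - -1 * steklovs d l h x0 <=
  tau ^+ 2 + tau * G + K2 * c' * tau ^+ 2.
  have cw : continuous w by case: Cw.
  apply: (@resolvent_comparison _ _ _ _ lam0 lamLam A (fun x => -1 * w x) (fun x =>
    -1 * steklovs d l h x)
     (fun x => -1 * steklovs d l p x) x0 r1 tau G _ (2 * M +
       tau ^+ 2) K2 eA r10 (ltW tau0) K20).
  - by case: (C2Z (-1) Cw).
  - exact: C2Z.
  - move=> x; rewrite lapZ // lapsh.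
    have -> : p = (fun y => - tau * lap A h y + h y) by apply/funext => y;
      rewrite -hp; ring.
    by rewrite (steklovs_linear d01) //; ring.
  - move=> x xx0; apply: (C2_lin_sub_at lam0 eA (C2Z _ Cw)).
    by rewrite lapZ // mulN1r opprK; exact: Hr1.
  - move=> x /sub_near H.
    have : `|steklovs d l u x - steklovs d l p x| <= tau ^+ 2.
      by apply: (steklovs_dist d01) => // y /H; exact: pu.
    by rewrite -/w ler_norml => /andP[? ?]; lra.
  - move=> x /sub_near H.
    have : `|steklovs d l u x - steklovs d l (fun=> 0) x| <= M + tau ^+ 2.
      apply: (steklovs_dist d01) => //; first exact: cst_continuous.
      by move=> y /H /uM; rewrite subr0.
    have : `|steklovs d l h x - steklovs d l (fun=> 0) x| <= M.
      apply: (steklovs_dist d01) => //; first exact: cst_continuous.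
      by move=> y _; rewrite subr0.
    rewrite (steklovs_cst d01) !subr0 -/w !ler_norml => /andP[_ h2] /andP[h3 _].
    lra.
  - by rewrite /K2 divfK ?gt_eqF //; lra.
have -> : tau * (F + G) + (2 + (K1 + K2) * c') * tau ^+ 2 =
  (tau ^+ 2 + tau * F + K1 * c' * tau ^+ 2) + (tau ^+ 2 + tau * G +
    K2 * c' * tau ^+ 2) by ring.
lra.
Qed.

(** The average depends on [u] alone, so one [w] serves all matrices [A] at once and thus the Pucci
    operator. Uniform continuity of [f] allows it to be frozen near each point. *)
Lemma smooth_subsolution u f a (rho eta : R) : continuous u -> continuous f ->
  (forall A x, ellipticity_set lam Lam A -> lin_sub_at A u (f x) x) -> 0 < eta ->
  exists2 w, C2 w & forall x, `|x - a| <= rho ->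
    `|w x - u x| <= eta /\
    forall A, ellipticity_set lam Lam A -> - lap A w x <= f x + eta.
Proof.
move=> cu cf usub eta0.
have K := @compact_ball_norm R N a rho.
have [d1 d10 H1] := uniformly_continuous_on_compact cu K eta0.
have [d2 d20 H2] := uniformly_continuous_on_compact cf K eta0.
pose r := Num.min 16^-1 (Num.min (d1 / 4) (d2 / 4)).
have r0 : 0 < r by rewrite !lt_min; apply/and3P; split; lra.
have r16 : r <= 16^-1 by rewrite ge_min lexx.
have rd1 : r <= d1 / 4 by rewrite !ge_min lexx !orbT.
have rd2 : r <= d2 / 4 by rewrite !ge_min lexx !orbT.
pose l := enum 'I_N ++ enum 'I_N.
pose d := r / ((size l)%:R + 1).
have s1 : 0 < (size l)%:R + 1 :> R by rewrite ltr_wpDl.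
have d0 : 0 < d by rewrite divr_gt0.
have dl1 : d * ((size l)%:R + 1) = r by rewrite /d divfK // gt_eqF.
have dl : d * (size l)%:R <= r by rewrite -dl1; apply: ler_wpM2l;
  [exact: ltW | rewrite lerDl].
have dr : d <= r by rewrite -dl1; apply: ler_peMr; [exact: ltW | rewrite lerDr].
have d01 : 0 < d <= 1 by rewrite d0 /=; lra.
exists (steklovs d l u); first exact: C2_steklovs.
move=> x xa; split.
  rewrite -[X in _ - X](steklovs_cst d01 l (u x) x).
  apply: (steklovs_dist d01) => //; first exact: cst_continuous.
  move=> y yx; apply: ltW; apply: H1 => //.
  by apply: le_lt_trans yx _; lra.
move=> A eA; apply: (steklov_lin_sub eA cu r0 _ d01 dl); first lra.
move=> z zx; apply: lin_sub_at_le (usub A z eA).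
have : `|f z - f x| < eta by apply: H2 => //; lra.
by rewrite ltr_norml => /andP[_ ?]; lra.
Qed.

End Smoothing.

(** * The difference of a supersolution and a subsolution *)

Section Pucci.
Variables (R : realType) (N : nat) (lam Lam : R).
Hypotheses (lam0 : 0 < lam) (lamLam : lam <= Lam).
Local Notation V := 'rV[R]_N.
Local Notation pucci := (pucci_max lam Lam).
Implicit Types (x y z : V) (A M : 'M[R]_N).

Definition mxabs M : R := \sum_i \sum_j `|M i j|.

(** It bounds the set whose supremum is [pucci_max], so that [sup] takes no default value, and it
    controls the effect of a small change of the Hessian. *)
Lemma elliptic_trace_bound A M : ellipticity_set lam Lam A ->
  - \tr (A *m M) <= N%:R * Lam * mxabs M.
Proof.
move=> eA; have /andP[_ tA] := elliptic_trace eA.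
have M0 : 0 <= mxabs M by apply: sumr_ge0 => i _; apply: sumr_ge0.
have [As _] := eA.
have [m [c [xi [c0 AE]]]] := posdef_decomposition As (elliptic_gt0 lam0 eA).
apply: (@le_trans _ _ (\tr A * mxabs M)); last exact: ler_wpM2r.
rewrite AE mulmx_suml ![\tr (\sum_(i | _) _)]raddf_sum /= mulr_suml -sumrN;
  apply: ler_sum => k _.
rewrite -scalemxAl !mxtraceZ -mulrN -mulrA; apply: ler_wpM2l => //.
rewrite mxtrace_mul_rank1 mxtrace_mulC trace_mx11 dotvE.
have -> : - (\sum_j xi k 0 j * \sum_i xi k 0 i * M i j) =
    \sum_i \sum_j (- (xi k 0 i * xi k 0 j)) * M i j.
  rewrite exchange_big /=.
  transitivity (\sum_j - (xi k 0 j * \sum_i xi k 0 i * M i j)); first by rewrite sumrN.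
  apply: eq_bigr => j _; rewrite mulr_sumr.
  transitivity (\sum_i - (xi k 0 j * (xi k 0 i * M i j))); first by rewrite sumrN.
  by apply: eq_bigr => i _; ring.
rewrite /mxabs mulr_sumr; apply: ler_sum => i _; rewrite mulr_sumr;
  apply: ler_sum => j _.
apply: le_trans (ler_norm _) _; rewrite normrM normrN; apply: ler_wpM2r => //.
have := coord_dotv (xi k) i; have := coord_dotv (xi k) j.
rewrite normrM -!(real_normK (num_real (xi k 0 _))).
move: `|xi k 0 i| `|xi k 0 j| => a b.
have := sqr_ge0 (a - b); lra.
Qed.

(** The witness that the supremum is not taken over the empty set. *)
Lemma elliptic_scalar : ellipticity_set lam Lam (lam%:M : 'M[R]_N).
Proof.
apply/ellipticityP; split; first by rewrite tr_scalar_mx.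
move=> x; rewrite -qformE mul_mx_scalar -scalemxAl mxE dotvE lexx /=.
by apply: ler_wpM2r => //; exact: dotv_ge0.
Qed.

Lemma pucci_le M (c : R) :
  (forall A, ellipticity_set lam Lam A -> - \tr (A *m M) <= c) -> pucci M <= c.
Proof.
move=> H; apply: ge_sup; first by exists (- \tr (lam%:M *m M)); exists lam%:M => //;
  exact: elliptic_scalar.
by move=> _ [A eA <-]; exact: H.
Qed.

Lemma pucci_ge M A : ellipticity_set lam Lam A -> - \tr (A *m M) <= pucci M.
Proof.
move=> eA; apply: ub_le_sup; last by exists A.
by exists (N%:R * Lam * mxabs M) => _ [B eB <-]; exact: elliptic_trace_bound.
Qed.

Lemma visc_sub_lin_sub_at q u A x : visc_sub lam Lam q u -> ellipticity_set lam Lam A ->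
  lin_sub_at A u (absorption q (u x)) x.
Proof.
move=> [_ H] eA phi Cphi Hphi; have := H phi x Cphi Hphi.
by rewrite subr_le0; apply: le_trans; rewrite lapE; exact: pucci_ge.
Qed.

(** * The absorption term *)

Lemma absorption_ge0E (q z : R) : 0 <= z -> absorption q z = z `^ (q - 1) * z.
Proof. by move=> z0; rewrite /absorption ger0_norm. Qed.

Lemma absorptionN (q z : R) : absorption q (- z) = - absorption q z.
Proof. by rewrite /absorption normrN mulrN. Qed.

Lemma absorption_ge0 (q z : R) : 0 <= z -> 0 <= absorption q z.
Proof. by move=> z0; rewrite /absorption mulr_ge0 // powR_ge0. Qed.

Lemma absorption_le (q a b : R) : 1 <= q -> 0 <= a -> a <= b ->
  absorption q a <= absorption q b.
Proof.
move=> q1 a0 ab; have b0 := le_trans a0 ab.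
rewrite !absorption_ge0E //; apply: ler_pM => //; first exact: powR_ge0.
by apply: ge0_ler_powR; rewrite ?nnegrE ?subr_ge0.
Qed.

Lemma continuous_absorption (q : R) : 1 <= q -> continuous (absorption q).
Proof.
move=> q1 z; have [->|z0] := eqVneq z 0.
  apply/cvgrPdist_le => e e0.
  have a0 : absorption q 0 = 0 by rewrite /absorption mulr0.
  near=> t; rewrite a0 sub0r normrN /absorption normrM ger0_norm ?powR_ge0 //.
  have t1 : `|t| <= Num.min 1 e.
    near: t; apply/nbhs_ballP; exists (Num.min 1 e) => /=;
      first by rewrite lt_min ltr01.
    by move=> t; rewrite /ball /= sub0r normrN => /ltW.
  move: t1; rewrite le_min => /andP[t1 te].
  apply: le_trans te; apply: ler_piMl => //.
  have : `|t| `^ (q - 1) <= 1 `^ (q - 1).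
    by apply: ge0_ler_powR; rewrite ?nnegrE ?subr_ge0.
  by rewrite powR1.
apply: (cvgM _ cvg_id).
apply: (@continuous_comp _ _ _ (fun z : R => `|z|) (fun t : R => t `^ (q - 1))).
  exact: norm_continuous.
apply/differentiable_continuous/derivable1_diffP.
by apply: derivable_powR; rewrite in_itv /= andbT normr_gt0.
Unshelve. all: by end_near. Qed.

(** By oddness one may assume [a + b >= 0], so that [(b - a) / 2 <= b]. For [a <= 0] the second term
    only helps; for [a > 0] one uses [b^(q-1) (b - a) <= b^q - a^q]. This is the source of the
    factor [2^-q]. *)
Lemma absorption_sub (q a b : R) : 1 <= q -> a <= b ->
  absorption q ((b - a) / 2) <= absorption q b - absorption q a.
Proof.
move=> q1; wlog ab0 : a b / 0 <= a + b.
  move=> H ab; have [/H|/ltW neg] := leP 0 (a + b); first exact.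
  have := H (- b) (- a); rewrite !absorptionN !opprK lerN2.
  by rewrite [- a + b]addrC [- absorption q a + _]addrC; apply => //; lra.
move=> ab; have d0 : 0 <= (b - a) / 2 by lra.
have db : (b - a) / 2 <= b by lra.
have [a0|a0] := leP a 0.
  apply: le_trans (absorption_le q1 d0 db) _; rewrite lerDl -absorptionN.
  by apply: absorption_ge0; rewrite oppr_ge0.
have b0 : 0 <= b by exact: le_trans db.
rewrite (absorption_ge0E q d0) (absorption_ge0E q b0) (absorption_ge0E q (ltW a0)).
apply: (@le_trans _ _ (b `^ (q - 1) * (b - a))).
  apply: ler_pM => //; [exact: powR_ge0 | | lra].
  by apply: ge0_ler_powR; rewrite ?nnegrE ?subr_ge0.
rewrite mulrBr lerD2l lerN2; apply: ler_wpM2r; first exact: ltW.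
by apply: ge0_ler_powR; rewrite ?nnegrE ?subr_ge0 ?(ltW a0).
Qed.

(* The subsolution is replaced by its smooth approximation [w], so that
   [phi + w] becomes an admissible test function for [v]; the quadratic term
   makes the minimum strict. *)
Lemma difference_supersolution q u v phi x0 : 1 <= q ->
  visc_sub lam Lam q u -> visc_super lam Lam q v -> C2 phi ->
  (\forall x \near x0, (v x0 - u x0) - phi x0 <= (v x - u x) - phi x) ->
  absorption q (v x0) - absorption q (u x0) <= pucci (hessian phi x0).
Proof.
move=> q1 subu [cv superv] Cphi /near_rVP[r0 r00 Hmin].
have Pge A : ellipticity_set lam Lam A ->
  - \tr (A *m hessian phi x0) <= pucci (hessian phi x0).
  exact: pucci_ge.
move: (pucci (hessian phi x0)) Pge => P0 Pge.
have cu : continuous u by case: subu.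
have cabs := continuous_absorption q1.
have cau : continuous (fun x => absorption q (u x)).
  by move=> x; apply: continuous_comp; [exact: cu | exact: cabs].
have cav : continuous (fun x => absorption q (v x)).
  by move=> x; apply: continuous_comp; [exact: cv | exact: cabs].
have N0 : 0 <= N%:R :> R by [].
have Lam0 : 0 < Lam by exact: lt_le_trans lamLam.
have NL0 : 0 <= N%:R * Lam by rewrite mulr_ge0 // ltW.
apply/ler_addgt0Pr => e e0.
have e8 : 0 < e / 8 by rewrite divr_gt0.
(* The quadratic penalty then changes the operator by at most [e / 8]; the other four errors are
   also at most [e / 8] each. *)
pose kappa := e / 16 / (N%:R * Lam + 1).
have NL1 : 0 < N%:R * Lam + 1 by rewrite ltr_wpDl.
have kappa0 : 0 < kappa by rewrite !divr_gt0.
have kappaE : 2 * kappa * (N%:R * Lam) <= e / 8.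
  have : kappa * (N%:R * Lam + 1) = e / 16 by rewrite /kappa divfK // gt_eqF.
  by move=> H; have := ltW kappa0; lra.
have cH : continuous (fun x => N%:R * Lam * mxabs (hessian phi x - hessian phi x0)).
  have [_ _ _ _ c2] := C2_grad Cphi.
  have cm : continuous (fun x => mxabs (hessian phi x - hessian phi x0)).
    apply: continuous_sumf => i; apply: continuous_sumf => j x.
    have -> : (fun x => `|(hessian phi x - hessian phi x0) i j|) =
       (fun x => `|partial (partial phi j) i x - partial (partial phi j) i x0|).
      by apply/funext => y; congr `|_|;
        rewrite [LHS]mxE [X in X + _ = _]mxE [X in _ + X = _]mxE [X in - X]mxE.
    exact: (cvg_norm (cvgB (c2 j i x) (cvg_cst _))).
  by move=> x; exact: (cvgM (cvg_cst _) (cm x)).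
have /continuousPnorm/(_ x0 _ e8)[r1 r10 H1] := cau.
have /continuousPnorm/(_ x0 _ e8)[r2 r20 H2] := cav.
have [r3 r30 H3] : exists2 r3 : R, 0 < r3 & forall y, `|y - x0| < r3 ->
    N%:R * Lam * mxabs (hessian phi y - hessian phi x0) < e / 8.
  have /continuousPnorm/(_ x0 _ e8)[r3 r30 H] := cH; exists r3 => // y /H.
  rewrite [X in _ - X](_ : _ = 0); last first.
    by rewrite subrr /mxabs big1 ?mulr0 // => i _; apply: big1 => j _;
      rewrite mxE normr0.
  by rewrite subr0; apply: le_lt_trans; exact: ler_norm.
pose r := Num.min (Num.min r0 r1) (Num.min r2 r3) / 2.
have m0 : 0 < Num.min (Num.min r0 r1) (Num.min r2 r3)
  by rewrite !lt_min r00 r10 r20 r30.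
have rp : 0 < r by rewrite divr_gt0.
have [ra rb rc rd] : [/\ r < r0, r < r1, r < r2 & r < r3].
  have : r < Num.min (Num.min r0 r1) (Num.min r2 r3) by rewrite /r; lra.
  by rewrite !lt_min => /andP[/andP[? ?] /andP[? ?]].
(* Replacing [u] by [w] shifts differences of values by at most [2 eta], less than the gain
   [kappa r^2] on the boundary, so the minimum stays interior. *)
pose eta := Num.min (e / 8) (kappa * r ^+ 2 / 4).
have kr0 : 0 < kappa * r ^+ 2 by rewrite mulr_gt0 // exprn_gt0.
have eta0 : 0 < eta by rewrite lt_min e8 divr_gt0.
have eta1 : eta <= e / 8 by rewrite ge_min lexx.
have eta2 : eta <= kappa * r ^+ 2 / 4 by rewrite ge_min lexx orbT.
have [w Cw Hw] := @smooth_subsolution R N lam Lam lam0 lamLam u _ x0 r eta cu cau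
  (fun A x eA => visc_sub_lin_sub_at subu eA) eta0.
have Dg (s : R) : 0 <= s -> is_derive s 1 (fun t =>
  0 * t ^+ 2 + (- kappa) * t + 0) (- kappa).
  by move=> _; have := is_derive_quadratic 0 (- kappa) 0 s; rewrite mulr0 mul0r add0r.
have Dg1 (s : R) : 0 <= s -> is_derive s 1 (fun _ => - kappa) 0.
  by move=> _; exact: is_derive_cst.
have [Cg Hg] := @C2_radial R N _ _ (fun _ => 0) x0 Dg Dg1 (fun s _ => cvg_cst _).
set g := (fun x => _) in Cg Hg.
have gE x : g x = - kappa * dotv (x - x0) (x - x0) by rewrite /g; ring.
clearbody g.
have Cpsi := C2D Cw (C2D Cphi Cg).
pose D := [set x | dotv (x - x0) (x - x0) <= r ^+ 2].
have cD : compact D by apply: compact_ball2; exact: ltW.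
have Dx0 : D x0 by rewrite /D /= subrr dotv0 sqr_ge0.
have DE x : D x -> `|x - x0| <= r by exact: norm_le_dotv (ltW rp).
have cf : continuous (fun x => v x - (w x + (phi x + g x))).
  by move=> x; exact: (cvgB (cv x) (Cpsi.1 x)).
have [x1 /set_mem Dx1 x1min] := EVT_min_rV (ex_intro _ x0 Dx0) cD
  (continuous_subspaceT cf).
have nx1 := DE _ Dx1.
have int : dotv (x1 - x0) (x1 - x0) < r ^+ 2.
  rewrite ltNge; apply/negP => bd.
  have E : dotv (x1 - x0) (x1 - x0) = r ^+ 2 by apply/eqP; rewrite eq_le bd andbT.
  have := x1min x0 (mem_set Dx0); rewrite !gE E subrr dotv0 mulr0 addr0.
  have := Hmin x1 (le_lt_trans nx1 ra).
  have [+ _] := Hw x1 nx1; have [+ _] := Hw x0 (DE _ Dx0).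
  by rewrite !ler_norml => /andP[? ?] /andP[? ?]; lra.
have := superv _ x1 Cpsi.
set P := (X in (X -> _) -> _) => HP.
have {}/HP : P.
  near=> x; apply: x1min; rewrite inE /D /=; apply: ltW; near: x.
  exact: near_dotv_lt.
rewrite subr_ge0 => Hv.
have Hp : pucci (hessian (fun x => w x + (phi x + g x)) x1) <=
   absorption q (u x1) + eta + (P0 + e / 8) + e / 8.
  apply: pucci_le => A eA; rewrite -lapE.
  rewrite (lapD A x1 Cw (C2D Cphi Cg)) (lapD A x1 Cphi Cg).
  have [_ /(_ A eA) Hw1] := Hw x1 nx1.
  have Hg1 : lap A g x1 = - (2 * kappa * \tr A).
    rewrite lapE Hg mulr0 scale0r add0r mul_mx_scalar mxtraceZ; ring.
  have /andP[_ tA] := elliptic_trace eA.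
  have tA2 : 2 * kappa * \tr A <= 2 * kappa * (N%:R * Lam).
    by apply: ler_wpM2l => //; rewrite mulr_ge0 // ltW.
  have Hphi1 : - lap A phi x1 <= P0 + e / 8.
    have -> : - lap A phi x1 = - \tr (A *m hessian phi x0) +
      - \tr (A *m (hessian phi x1 - hessian phi x0)).
      by rewrite lapE mulmxBr [\tr (_ - _)]raddfB /= -opprD subrKC.
    apply: lerD; first exact: Pge.
    by apply: le_trans (elliptic_trace_bound _ eA) _; apply/ltW/H3/(le_lt_trans nx1 rd).
  lra.
move: (le_trans Hv Hp) => {}Hp {Hv}.
have := H1 x1 (le_lt_trans nx1 rb); have := H2 x1 (le_lt_trans nx1 rc).
rewrite !ltr_norml => /andP[? ?] /andP[? ?]; lra.
Unshelve. all: by end_near. Qed.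

End Pucci.

(** * The Liouville theorem *)

Section PowerLog.
Variable R : realType.
Implicit Types a b c d e s t : R.

Lemma gt0_powRD t a b : 0 < t -> t `^ (a + b) = t `^ a * t `^ b.
Proof. by move=> t0; rewrite powRD //; apply/implyP => _; rewrite gt_eqF. Qed.

Lemma powRS t a : 0 < t -> t `^ (a + 1) = t `^ a * t.
Proof. by move=> t0; rewrite gt0_powRD // powRr1 ?ltW. Qed.

(** Differentiation keeps this family and raises [a] by one, so a single rule serves the power
    profile and the logarithmic one. *)
Definition powlog a c d e s : R := (s + e) `^ (- a) * (c + d * ln (s + e)).

Lemma is_derive_powlog a c d e s : 0 < s + e ->
  is_derive s 1 (powlog a c d e) (powlog (a + 1) (d - a * c) (- (a * d)) e s).
Proof.
move=> se0.
have sh : is_derive s 1 (fun t : R => t + e) 1.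
  have := is_derive_quadratic 0 1 e s; rewrite mulr0 mul0r add0r.
  have -> // : (fun t : R => 0 * t ^+ 2 + 1 * t + e) = fun t => t + e.
  by apply/funext => t; ring.
have Dp := @is_derive1_comp R (@powR R ^~ (- a)) (fun t : R =>
  t + e) s _ _ (is_derive1_powR _ se0) sh.
have Dl := @is_derive1_comp R (@ln R) (fun t : R => t + e) s _ _ (is_derive1_ln se0) sh.
have -> : powlog a c d e = ((@powR R ^~ (- a)) \o (fun t : R => t + e)) *
    (cst c + d *: (@ln R \o (fun t : R => t + e))) by [].
apply: is_derive_eq (is_deriveM Dp (is_deriveD (is_derive_cst c s 1) (is_deriveZ d
  Dl))) _.
rewrite /powlog /GRing.scale /= !mulr1 add0r.
have -> : - (a + 1) = - a - 1 by ring.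
have -> : (s + e) `^ (- a) = (s + e) `^ (- a - 1) * (s + e) by rewrite -powRS // subrK.
rewrite -[X in _ + X = _]/((c + d * ln (s + e)) * (- a * (s + e) `^ (- a - 1))).
by move: (_ `^ _) (ln _) => p l; field; rewrite gt_eqF.
Qed.

Lemma powR_le_antimono a s t : 0 <= a -> 0 < s -> s <= t -> t `^ (- a) <= s `^ (- a).
Proof.
move=> a0 s0 st; have t0 := lt_le_trans s0 st.
rewrite !powRN lef_pV2 ?posrE ?powR_gt0 //.
by apply: ge0_ler_powR => //; rewrite nnegrE ltW.
Qed.

Lemma powR_vanish a e : 0 < a -> 0 < e -> exists2 T0, 1 <= T0 & forall T, T0 <= T ->
  T `^ (- a) <= e.
Proof.
move=> a0 e0; pose T1 := e^-1 `^ a^-1.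
exists (Num.max 1 T1); first by rewrite le_max lexx.
move=> T; rewrite ge_max => /andP[T1le Tle].
have T10 : 0 < T1 by rewrite powR_gt0 // invr_gt0.
apply: le_trans (powR_le_antimono (ltW a0) T10 Tle) _.
have e10 : 0 <= e^-1 by rewrite invr_ge0 ltW.
by rewrite powRN /T1 -powRrM mulVf ?gt_eqF // powRr1 // invrK lexx.
Qed.

Lemma ln_le_id t : 0 < t -> ln t <= t.
Proof. by move=> t0; have := le_ln1Dx (_ : -1 < t - 1); rewrite subrKC => H;
  apply: le_trans (H _) _; lra. Qed.

(** Half of the exponent absorbs the logarithm: [(a / 2) ln T <= T^(a/2)]. *)
Lemma powlog_vanish a e : 0 < a -> 0 < e ->
  exists2 T0, 1 <= T0 & forall T, T0 <= T -> T `^ (- a) * ln T <= e.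
Proof.
move=> a0 e0; have a20 : 0 < a / 2 by rewrite divr_gt0.
have [T0 T01 H] := powR_vanish a20 (mulr_gt0 e0 a20).
exists T0 => // T TT; have T1 : 1 <= T by exact: le_trans TT.
have Tp : 0 < T by exact: lt_le_trans T1.
have L : a / 2 * ln T <= T `^ (a / 2) by rewrite -ln_powR ln_le_id // powR_gt0.
rewrite -(ler_pM2r a20); apply: le_trans (H T TT).
rewrite -mulrA [ln T * _]mulrC.
have -> : T `^ (- (a / 2)) = T `^ (- a) * T `^ (a / 2).
  by rewrite -gt0_powRD //; congr (_ `^ _); field.
by apply: ler_wpM2l => //; exact: powR_ge0.
Qed.

End PowerLog.

(** * The Pucci operator on radial functions *)

Section RadialPucci.
Variables (R : realType) (N : nat) (lam Lam : R).
Hypotheses (lam0 : 0 < lam) (lamLam : lam <= Lam) (N1 : (1 <= N)%N).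
Local Notation V := 'rV[R]_N.
Implicit Types (z : V).

(** The Hessian has one radial eigenvalue [2 g1 + 4 s g2 >= 0] and tangential eigenvalues
    [2 g1 <= 0]. Instead of diagonalizing, the tangential part of the trace of [A] is bounded by
    [qform_le_trace] applied to [Lam I - A]. *)
Lemma pucci_radial_le z (g1 g2 : R) : 0 < dotv z z -> g1 <= 0 ->
  0 <= 2 * g1 + 4 * dotv z z * g2 ->
  pucci_max lam Lam ((4 * g2) *: (z^T *m z) + (2 * g1)%:M) <=
  - lam * (2 * g1 + 4 * dotv z z * g2) - 2 * g1 * (Lam * (N.-1)%:R).
Proof.
move=> s0 g10 a0; apply: pucci_le => // A eA.
rewrite mulmxDr mxtraceD -scalemxAr mxtraceZ mxtrace_qform mul_mx_scalar mxtraceZ.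
have [As /(_ z) /andP[q1 q2]] := iffLR (ellipticityP lam Lam A) eA.
have NE : (N.-1)%:R = N%:R - 1 :> R by rewrite -[N in RHS]prednK // -natr1 addrK.
set s := dotv z z in s0 a0 q1 q2 *.
have H : s * \tr A - qform A z <= s * (Lam * (N.-1)%:R).
  pose B := Lam%:M - A.
  have qB x : qform B x = Lam * dotv x x - qform A x.
    by rewrite -!qformE /B mulmxBr mulmxBl mul_mx_scalar -scalemxAl mxE [X in X +
      _]mxE [X in _ + X]mxE dotvE.
  have Bs : B^T = B by rewrite /B linearB /= tr_scalar_mx As.
  have Bp x : 0 <= qform B x.
    rewrite qB subr_ge0; have [_ /(_ x)] := iffLR (ellipticityP lam Lam A) eA.
    by case/andP.
  have := qform_le_trace Bp Bs z;
    rewrite qB /B raddfB /= mxtrace_scalar -/s NE -mulr_natr.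
  lra.
move: (\tr A) (qform A z) q1 q2 H => t Q q1 q2 H.
rewrite -(ler_pM2l s0).
have K1 : (2 * g1 + 4 * s * g2) * (lam * s) <= (2 * g1 + 4 * s * g2) * Q
  by exact: ler_wpM2l.
have K2 : - g1 * (s * t - Q) <= - g1 * (s * (Lam * (N.-1)%:R)) by apply: ler_wpM2l =>
  //; rewrite oppr_ge0.
lra.
Qed.

End RadialPucci.

Section Liouville.
Variables (R : realType) (N : nat) (lam Lam q ga : R).
Hypotheses (lam0 : 0 < lam) (lamLam : lam <= Lam) (N1 : (1 <= N)%N).
Hypotheses (ga0 : 0 < ga) (LamN : Lam * (N.-1)%:R = lam * (2 * ga + 1)).
Hypotheses (q1 : 1 <= q) (qga : (q - 1) * ga <= 1).
Local Notation V := 'rV[R]_N.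
Local Notation pucci := (pucci_max lam Lam).
Variables (w : V -> R) (y : V).
Hypotheses (cw : continuous w) (w0 : forall x, 0 <= w x).
Hypothesis w_super : forall (phi : V -> R) x0, C2 phi ->
  (\forall x \near x0, w x0 - phi x0 <= w x - phi x) ->
  absorption q (w x0 / 2) <= pucci (hessian phi x0).
Implicit Types (x z : V).

Local Notation sq x := (dotv (x - y) (x - y)).

(** The minimum of [w - phi] over [D] is negative, hence interior by the last hypothesis, so [phi]
    is a test function there. *)
Lemma contact_point phi (D : set V) z : C2 phi -> compact D -> D z -> w z < phi z ->
  (forall x, D x -> w x < phi x -> \forall x' \near x, D x') ->
  exists x, [/\ D x, w x < phi x & absorption q (w x / 2) <= pucci (hessian phi x)].
Proof.
move=> Cphi cD Dz wz Dint.
have cf : continuous (fun x => w x - phi x).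
  by move=> x; exact: (cvgB (@cw x) (Cphi.1 x)).
have [x /set_mem Dx xmin] := EVT_min_rV (ex_intro _ z Dz) cD (continuous_subspaceT cf).
have wx : w x < phi x by have := xmin z (mem_set Dz) => /= H; lra.
exists x; split=> //; apply: w_super => //.
have := Dint x Dx wx; apply: filterS => x' Dx'.
exact: xmin (mem_set Dx').
Qed.

Lemma compact_annulus (a b : R) : 0 <= b -> compact [set x | a <= sq x <= b].
Proof.
move=> b0.
have cg : continuous (fun x => Num.max (a - sq x) (sq x - b)).
  have c1 : continuous (fun x => a - sq x).
    by move=> x; exact: (cvgB (cvg_cst _) (@continuous_dist2 _ _ y x)).
  have c2 : continuous (fun x => sq x - b).
    by move=> x; exact: (cvgB (@continuous_dist2 _ _ y x) (cvg_cst _)).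
  by move=> x; exact: (continuous_max (c1 x) (c2 x)).
have -> : [set x | a <= sq x <= b] = [set x | Num.max (a - sq x) (sq x - b) <= 0].
  by apply/funext => x /=; rewrite ge_max !subr_le0.
apply: (@compact_le _ _ _ _ (Num.sqrt b + `|y|)) => // x;
  rewrite ge_max !subr_le0 => /andP[_ H].
rewrite -[x in `|x|](subrK y); apply: le_trans (ler_normD _ _) _; rewrite lerD2r.
by apply: norm_le_dotv; [exact: sqrtr_ge0 | rewrite sqr_sqrtr].
Qed.

Lemma near_sq_gt x (c : R) : c < sq x -> \forall z \near x, c < sq z.
Proof.
move=> H; have := @continuous_dist2 R N y x.
by move=> /(@cvgr_gt _ _ _ (nbhs_filter x)) /(_ _ H).
Qed.

(** By [LamN] the radial bound collapses to [-4 lam ((ga + 1) g1 + s g2)], which vanishes for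
    [s^-ga]. On the outer sphere only [w >= 0] is known, hence the condition [g b <= 0]. *)
Lemma annulus_comparison (g g1 g2 : R -> R) (a b : R) : 0 < a ->
  (forall s : R, 0 <= s -> is_derive s 1 g (g1 s)) ->
  (forall s : R, 0 <= s -> is_derive s 1 g1 (g2 s)) ->
  (forall s : R, 0 <= s -> {for s, continuous g2}) ->
  (forall x, sq x = a -> g a <= w x) -> g b <= 0 ->
  (forall x, a < sq x < b -> w x < g (sq x) ->
    [/\ g1 (sq x) <= 0, 0 <= 2 * g1 (sq x) + 4 * sq x * g2 (sq x) &
     - 4 * lam * ((ga + 1) * g1 (sq x) + sq x * g2 (sq x)) < absorption q (w x / 2)]) ->
  forall x, a <= sq x <= b -> g (sq x) <= w x.
Proof.
move=> a0 Dg Dg1 cg2 ga_ gb H x xI; rewrite leNgt; apply/negP => wx.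
have [Cphi Hphi] := @C2_radial R N g g1 g2 y Dg Dg1 cg2.
have b0 : 0 <= b by have /andP[h1 h2] := xI; apply: le_trans h2; apply: dotv_ge0.
have int z : a <= sq z <= b -> w z < g (sq z) -> a < sq z < b.
  move=> /andP[h1 h2] wz; rewrite !lt_neqAle h1 h2 !andbT; apply/andP; split;
    apply/negP => /eqP E.
    by have := ga_ z (esym E); rewrite leNgt E wz.
  by move: wz; rewrite E ltNge (le_trans gb).
have Dint z : a <= sq z <= b -> w z < g (sq z) -> \forall z' \near z, a <= sq z' <= b.
  move=> Dz wz; have /andP[i1 i2] := int z Dz wz.
  by near=> z'; apply/andP; split; apply: ltW; near: z';
    [exact: near_sq_gt | exact: near_dotv_lt].
have [z [Dz wz]] := contact_point Cphi (@compact_annulus a b b0) xI wx Dint.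
have [h1 h2 h3] := H z (int z Dz wz) wz; have /andP[i1 i2] := int z Dz wz.
rewrite Hphi leNgt => /negP; apply; apply: le_lt_trans h3.
apply: le_trans (pucci_radial_le lamLam N1 (lt_trans a0 i1) h1 h2) _.
by rewrite LamN le_eqVlt; apply/orP; left; apply/eqP; ring.
Unshelve. all: by end_near. Qed.

(* The perturbation [sg (s + e)^(-ga-1)] makes the radial function a strict
   subsolution, and the shift [e] makes it smooth at the origin. *)
Lemma power_lower_bound (sg m : R) : 0 < sg -> 0 <= m ->
  (forall x, sq x = sg -> m <= w x) ->
  forall x, sg <= sq x -> m / 2 * sg `^ ga * (2 * sq x) `^ (- ga) <= w x.
Proof.
move=> sg0; rewrite le_eqVlt => /predU1P[<- _ x _|m0 Hm x sx].
  by rewrite !mul0r w0.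
have gap := ga0.
(* Both terms of the profile [F] below are at most [sg^-ga] at [sg], so [k F sg <= m]. *)
set k := m / 2 * sg `^ ga.
have k0 : 0 < k by rewrite mulr_gt0 ?divr_gt0 // powR_gt0.
have km : k * (2 * sg `^ (- ga)) = m.
  have E : sg `^ ga * sg `^ (- ga) = 1 by rewrite -gt0_powRD // subrr powRr0.
  by rewrite /k; transitivity (m * (sg `^ ga * sg `^ (- ga)));
    [field | rewrite E mulr1].
clearbody k.
have ga10 : 0 < ga + 1 by lra.
pose e := sg / (4 * (ga + 1)).
have e0 : 0 < e by rewrite divr_gt0 // mulr_gt0.
have eE : (ga + 1) * e = sg / 4 by rewrite /e; field; rewrite gt_eqF.
clearbody e.
have gae : 0 < ga * e by rewrite mulr_gt0.
have e4 : e <= sg / 4 by move: eE; rewrite mulrDl mul1r => eE'; lra.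
pose F (s : R) := powlog ga 1 0 e s + sg * powlog (ga + 1) 1 0 e s.
pose F1 (s : R) := powlog (ga + 1) (0 - ga * 1) (- (ga * 0)) e s +
   sg * powlog (ga + 1 + 1) (0 - (ga + 1) * 1) (- ((ga + 1) * 0)) e s.
pose F2 (s : R) := powlog (ga + 1 + 1) (- (ga * 0) - (ga +
  1) * (0 - ga * 1)) (- ((ga + 1) * - (ga * 0))) e s +
   sg * powlog (ga + 1 + 1 + 1) (- ((ga + 1) * 0) - (ga + 1 + 1) * (0 - (ga + 1) * 1))
     (- ((ga + 1 + 1) * - ((ga + 1) * 0))) e s.
have se (s : R) : 0 <= s -> 0 < s + e by move=> ?; rewrite ltr_wpDl.
have DF (s : R) : 0 <= s -> is_derive s 1 F (F1 s).
  by move=> /se H; apply: (is_deriveD (is_derive_powlog _ _ _ H) (is_deriveZ sg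
    (is_derive_powlog _ _ _ H))).
have DF1 (s : R) : 0 <= s -> is_derive s 1 F1 (F2 s).
  by move=> /se H; apply: (is_deriveD (is_derive_powlog _ _ _ H) (is_deriveZ sg
    (is_derive_powlog _ _ _ H))).
have cpl a c d (s : R) : 0 <= s -> {for s, continuous (powlog a c d e)}.
  move=> /se H; apply/differentiable_continuous/derivable1_diffP.
  by case: (is_derive_powlog a c d H).
have cF2 (s : R) : 0 <= s -> {for s, continuous F2}.
  by move=> H; exact: (cvgD (cpl _ _ _ _ H) (cvgM (cvg_cst sg) (cpl _ _ _ _ H))).
have FE (s : R) : F s = (s + e) `^ (- ga) + sg * (s + e) `^ (- (ga + 1)).
  by rewrite /F /powlog !mul0r !addr0 !mulr1.
have F12E (s : R) : 0 < s -> let t := s + e in let p := t `^ (- (ga + 1 + 1 + 1)) in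
    F1 s = - p * (ga * t * t + sg * (ga + 1) * t) /\
    F2 s = p * (ga * (ga + 1) * t + sg * (ga + 1) * (ga + 2)).
  move=> s0 t p; have t0 : 0 < t by exact: addr_gt0.
  have E2 : t `^ (- (ga + 1 + 1)) = p * t by rewrite -powRS //; congr (_ `^ _); ring.
  have E1 : t `^ (- (ga + 1)) = p * t * t by rewrite -E2 -powRS //; congr (_ `^ _);
    ring.
  by split; rewrite ?/F1 ?/F2 /powlog -/t ?E1 E2 -/p; ring.
clearbody F F1 F2.
(* Subtracting [k F T] makes the profile vanish on the outer sphere; [T] then tends to infinity. *)
have main (T : R) : sq x <= T -> k * F (sq x) - k * F T <= w x.
  move=> xT.
  apply: (@annulus_comparison (fun s => k * F s + - (k * F T)) (fun s =>
    k * F1 s) (fun s => k * F2 s) sg T sg0).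
  - move=> s s0; rewrite -[k * F1 s]addr0.
    exact: (is_deriveD (is_deriveZ k (DF s s0)) (is_derive_cst _ _ _)).
  - by move=> s s0; exact: (is_deriveZ k (DF1 s s0)).
  - by move=> s s0; exact: (cvgM (cvg_cst k) (cF2 s s0)).
  - move=> z zs; apply: le_trans (Hm z zs).
    have T0 : 0 <= T by apply: le_trans xT; exact: dotv_ge0.
    have FT : 0 <= F T by rewrite FE addr_ge0 ?mulr_ge0 ?powR_ge0 // ltW.
    have FS : F sg <= 2 * sg `^ (- ga).
      have h1 : (sg + e) `^ (- ga) <= sg `^ (- ga) by apply: powR_le_antimono; lra.
      have h2 : (sg + e) `^ (- (ga + 1)) <= sg `^ (- (ga + 1))
        by apply: powR_le_antimono; lra.
      have h3 : sg `^ (- ga) = sg `^ (- (ga + 1)) * sg by rewrite -powRS //;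
        congr (_ `^ _); ring.
      have h4 : sg * (sg + e) `^ (- (ga + 1)) <= sg * sg `^ (- (ga + 1))
        by apply: ler_wpM2l => //; exact: ltW.
      by rewrite FE; lra.
    have h5 : k * F sg <= k * (2 * sg `^ (- ga)) by apply: ler_wpM2l => //; exact: ltW.
    have h6 : 0 <= k * F T by rewrite mulr_ge0 // ltW.
    by move: h5; rewrite km => h5; lra.
  - by rewrite subrr.
  - move=> z /andP[z1 z2] _.
    have s0 := lt_trans sg0 z1.
    set s := sq z in z1 z2 s0 *; set t := s + e.
    have t0 : 0 < t by exact: addr_gt0.
    have [F1E F2E] := F12E s s0.
    move: F1E F2E; rewrite -/t; set p := t `^ _ => F1E F2E.
    have p0 : 0 < p by exact: powR_gt0.
    clearbody p.
    have kp : 0 < k * p by rewrite mulr_gt0.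
    have ts : t <= 5 / 4 * s by rewrite /t; lra.
    rewrite F1E F2E; split.
    + rewrite mulrA mulrN mulNr oppr_le0 mulr_ge0 ?(ltW kp) //.
      by rewrite addr_ge0 // !mulr_ge0 // ltW.
    + have -> : 2 * (k * (- p * (ga * t * t + sg * (ga + 1) * t))) +
         4 * s * (k * (p * (ga * (ga + 1) * t + sg * (ga + 1) * (ga + 2)))) =
         2 * (k * p) * (ga * t * (2 * s * ga + (2 * s - t)) +
            (ga + 1) * sg * (2 * s * ga + (4 * s - t))) by ring.
      have i1 : 0 <= 2 * s * ga by rewrite !mulr_ge0 // ltW.
      have i2 : 0 <= 2 * s - t by lra.
      have i3 : 0 <= 4 * s - t by lra.
      apply: mulr_ge0; first by rewrite mulr_ge0 // ltW.
      by apply: addr_ge0; apply: mulr_ge0;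
        do ?[exact: addr_ge0 | by rewrite mulr_ge0 // ltW].
    (* The perturbation gains a multiple of [sg * s], the shift loses one of [ga * e * t]; the
       choice [(ga + 1) e = sg / 4] makes the gain win for [s > sg]. *)
    + apply: (@lt_le_trans _ _ 0); last by apply: absorption_ge0; rewrite divr_ge0.
      have -> : - 4 * lam * ((ga + 1) * (k * (- p * (ga * t * t + sg * (ga + 1) * t))) +
          s * (k * (p * (ga * (ga + 1) * t + sg * (ga + 1) * (ga + 2))))) =
        - (4 * lam * (k * p) * (ga + 1) * (sg * (s - (ga + 1) * e) - ga * e * t)).
        by rewrite /t; ring.
      rewrite oppr_lt0 mulr_gt0 //; first by rewrite !mulr_gt0.
      rewrite eE subr_gt0.
      have gae' : ga * e <= sg / 4 by rewrite -eE mulrDl lerDl mul1r ltW.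
      apply: (@le_lt_trans _ _ (sg / 4 * t)); first by rewrite ler_pM2r.
      rewrite -subr_gt0.
      have -> : sg * (s - sg / 4) - sg / 4 * t = sg * (s - sg / 4 - t / 4) by field.
      by rewrite mulr_gt0 //; lra.
  - by rewrite sx xT.
have T0 := lt_le_trans sg0 sx.
apply/ler_addgt0Pr => r r0.
have k20 : 0 < 2 * k by rewrite mulr_gt0.
have [Tr Tr1 HT] := powR_vanish ga0 (divr_gt0 r0 k20).
pose T := Num.max Tr (sq x).
have TT : Tr <= T by rewrite le_max lexx.
have xT : sq x <= T by rewrite le_max lexx orbT.
have Tsg : sg <= T by exact: le_trans xT.
have Tp : 0 < T by exact: lt_le_trans xT.
have FT : k * F T <= r.
  have h1 : (T + e) `^ (- ga) <= T `^ (- ga) by apply: powR_le_antimono; lra.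
  have h2 : (T + e) `^ (- (ga + 1)) <= T `^ (- (ga + 1)) by apply: powR_le_antimono;
    lra.
  have h3 : T `^ (- ga) = T `^ (- (ga + 1)) * T by rewrite -powRS //; congr (_ `^ _);
    ring.
  have h4 : sg * (T + e) `^ (- (ga + 1)) <= T * T `^ (- (ga + 1)).
    by apply: ler_pM => //; [exact: ltW | exact: powR_ge0].
  have h5 : F T <= 2 * T `^ (- ga) by rewrite FE; lra.
  have := HT T TT; rewrite ler_pdivlMr // => h6.
  have := ler_wpM2l (ltW k0) h5; lra.
have := main T xT.
have h1 : (2 * sq x) `^ (- ga) <= (sq x + e) `^ (- ga) by apply: powR_le_antimono; lra.
have h2 : (sq x + e) `^ (- ga) <= F (sq x).
  by rewrite FE lerDl mulr_ge0 ?powR_ge0 // ltW.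
have := ler_wpM2l (ltW k0) (le_trans h1 h2); lra.
Qed.

Hypothesis wy : 0 < w y.

(** Positivity spreads from [y] to a small ball by continuity and from its boundary to the exterior
    by comparison: a strong minimum principle with a rate. *)
Lemma positive_lower_bound : (forall x, 0 < w x) /\
  exists2 C : R, 0 < C & forall x, 1 <= sq x -> C * sq x `^ (- ga) <= w x.
Proof.
have wy2 : 0 < w y / 2 by rewrite divr_gt0.
have /continuousPnorm/(_ y _ wy2)[r r0 Hr] := cw.
have Hr' x : `|x - y| < r -> w y / 2 <= w x.
  by move=> /Hr; rewrite ltr_norml => /andP[? ?]; lra.
pose sg := Num.min 1 ((r / 2) ^+ 2).
have sg0 : 0 < sg by rewrite lt_min ltr01 exprn_gt0 // divr_gt0.
have sg1 : sg <= 1 by rewrite ge_min lexx.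
have near_y x : sq x <= sg -> w y / 2 <= w x.
  move=> H; apply: Hr'; apply: (@le_lt_trans _ _ (r / 2)); last by lra.
  apply: norm_le_dotv; first by rewrite divr_ge0 // ltW.
  by apply: le_trans H _; rewrite ge_min lexx orbT.
pose C := w y / 2 / 2 * sg `^ ga * 2 `^ (- ga).
have C0 : 0 < C by rewrite !mulr_gt0 ?invr_gt0 // powR_gt0.
have low x : sg <= sq x -> C * sq x `^ (- ga) <= w x.
  move=> H; have := power_lower_bound sg0 (ltW wy2) (fun x E =>
    near_y x (eq_ind_r (fun t => t <= sg) (lexx sg) E)) H.
  by rewrite powRM ?dotv_ge0 // mulrA.
split=> [x|].
  have [H|H] := leP (sq x) sg; first exact: lt_le_trans (near_y x H).
  apply: lt_le_trans (low x (ltW H)); rewrite mulr_gt0 // powR_gt0 //.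
  exact: lt_trans H.
by exists C => // x H; apply: low; exact: le_trans H.
Qed.

(** The exponent condition enters here: [(s^-ga)^(q-1) >= s^-1] for [s >= 1]. *)
Lemma absorption_power (C s : R) : 0 < C -> 1 <= s ->
  absorption q C * s `^ (- (ga + 1)) <= absorption q (C * s `^ (- ga)).
Proof.
move=> C0 s1; have s0 : 0 < s by exact: lt_le_trans s1.
have sp : 0 < s `^ (- ga) by exact: powR_gt0.
rewrite !absorption_ge0E ?(ltW C0) ?(mulr_ge0 (ltW C0) (ltW sp)) // powRM ?(ltW C0)
  ?(ltW sp) //.
have -> : s `^ (- (ga + 1)) = s `^ (- ga) * s `^ (-1) by rewrite -gt0_powRD //;
  congr (_ `^ _); ring.
have H : s `^ (- 1) <= (s `^ (- ga)) `^ (q - 1).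
  by rewrite -powRrM; apply: ler_powR => //; rewrite mulNr lerN2 mulrC.
have -> : C `^ (q - 1) * C * (s `^ (- ga) * s `^ (-1)) =
  (C `^ (q - 1) * C * s `^ (- ga)) * s `^ (-1) by ring.
have -> : C `^ (q - 1) * (s `^ (- ga)) `^ (q - 1) * (C * s `^ (- ga)) =
  (C `^ (q - 1) * C * s `^ (- ga)) * (s `^ (- ga)) `^ (q - 1) by ring.
by apply: ler_wpM2l => //; rewrite !mulr_ge0 ?powR_ge0 // ltW.
Qed.

(* In the critical case the bound [w >= C |x|^(-2 ga)] turns the right-hand side
   into [c |x|^(-2 ga - 2)], which produces a logarithm. *)
Lemma log_lower_bound : exists kS : R * R, [/\ 0 < kS.1, 1 <= kS.2 &
  forall x, kS.2 <= sq x -> kS.1 * ((sq x + 1) `^ (- ga) * ln (sq x + 1)) <= w x].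
Proof.
have [_ [C C0 HC]] := positive_lower_bound.
have gap := ga0.
(* Beyond [S] one has [ga ln (s + 1) >= 2], which makes the logarithmic profile decreasing and
   convex along rays. *)
pose S := Num.max 1 (expR (2 / ga)).
have S1 : 1 <= S by rewrite le_max lexx.
have S0 : 0 < S by exact: lt_le_trans S1.
have lnS (s : R) : S <= s -> 2 <= ga * ln (s + 1).
  move=> Ss; have s0 := lt_le_trans S0 Ss.
  have : 2 / ga <= ln (s + 1).
    rewrite -[leLHS]expRK ler_ln ?posrE ?expR_gt0 ?addr_gt0 //.
    apply: (@le_trans _ _ S); first by rewrite le_max lexx orbT.
    by apply: le_trans Ss _; rewrite lerDl.
  by rewrite ler_pdivrMr // mulrC.
pose F (s : R) := powlog ga 0 1 1 s.
pose F1 (s : R) := powlog (ga + 1) (1 - ga * 0) (- (ga * 1)) 1 s.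
pose F2 (s : R) := powlog (ga + 1 + 1) (- (ga * 1) - (ga +
  1) * (1 - ga * 0)) (- ((ga + 1) * - (ga * 1))) 1 s.
have se (s : R) : 0 <= s -> 0 < s + 1 by move=> ?; rewrite ltr_wpDl.
have DF (s : R) : 0 <= s -> is_derive s 1 F (F1 s) by move=> /se H;
  exact: is_derive_powlog.
have DF1 (s : R) : 0 <= s -> is_derive s 1 F1 (F2 s) by move=> /se H;
  exact: is_derive_powlog.
have cF2 (s : R) : 0 <= s -> {for s, continuous F2}.
  move=> /se H; apply/differentiable_continuous/derivable1_diffP.
  by case: (is_derive_powlog (ga + 1 + 1) (- (ga * 1) - (ga +
    1) * (1 - ga * 0)) (- ((ga + 1) * - (ga * 1))) H).
have FE (s : R) : F s = (s + 1) `^ (- ga) * ln (s + 1)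
  by rewrite /F /powlog add0r mul1r.
have F12E (s : R) : 0 < s -> let t := s + 1 in let p := t `^ (- (ga + 1 + 1)) in
    F1 s = p * t * (1 - ga * ln t) /\ F2 s = p * (ga * (ga + 1) * ln t - (2 * ga + 1)).
  move=> s0 t p; have t0 : 0 < t by exact: addr_gt0.
  have E1 : t `^ (- (ga + 1)) = p * t by rewrite -powRS //; congr (_ `^ _); ring.
  by split; rewrite ?/F1 ?/F2 /powlog -/t ?E1 -/p; ring.
clearbody F F1 F2.
have Fp (s : R) : S <= s -> 0 <= F s.
  move=> Ss; have s0 := lt_le_trans S0 Ss.
  rewrite FE mulr_ge0 ?powR_ge0 // -(pmulr_rge0 _ ga0).
  by apply: le_trans (lnS s Ss).
pose E0 := absorption q (C / 2).
have E00 : 0 < E0.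
  by rewrite /E0 absorption_ge0E ?mulr_gt0 ?powR_gt0 ?divr_gt0 // divr_ge0 // ltW.
pose D := 8 * lam * (ga * (ga + 2)).
have ga2 : 0 < ga + 2 by lra.
have D0 : 0 < D by rewrite !mulr_gt0.
have Fp1 : 0 < F S + 1 by rewrite ltr_wpDl // Fp.
(* The first bound puts the profile below [w] on the inner sphere, the second lets the absorption
   pay for the residual of the logarithm; the factor 8 in [D] leaves a strict inequality. *)
pose k := Num.min (C * S `^ (- ga) / (F S + 1)) (E0 / D).
have k0 : 0 < k by rewrite lt_min !divr_gt0 // mulr_gt0 // powR_gt0.
have k1 : k * F S <= C * S `^ (- ga).
  have : k <= C * S `^ (- ga) / (F S + 1) by rewrite ge_min lexx.
  by rewrite ler_pdivlMr // mulrDr mulr1 => H; have := ltW k0; lra.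
have k2 : k * D <= E0.
  by rewrite -ler_pdivlMr // ge_min lexx orbT.
have k3 : 4 * lam * (k * (ga * (ga + 2))) < E0 by move: k2 E00;
  rewrite /D => k2' E00'; lra.
clearbody k D.
exists (k, S); split=> //= x Sx; rewrite -FE.
have main (T : R) : sq x <= T -> k * F (sq x) - k * F T <= w x.
  move=> xT.
  apply: (annulus_comparison (g := fun s => k * F s + - (k * F T))
    (g1 := fun s => k * F1 s) (g2 := fun s => k * F2 s) (b := T) S0).
  - move=> s s0; rewrite -[k * F1 s]addr0.
    exact: (is_deriveD (is_deriveZ k (DF s s0)) (is_derive_cst _ _ _)).
  - by move=> s s0; exact: (is_deriveZ k (DF1 s s0)).
  - by move=> s s0; exact: (cvgM (cvg_cst k) (cF2 s s0)).
  - move=> z zS; have := HC z; rewrite zS => /(_ S1); apply: le_trans.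
    apply: le_trans k1; rewrite /= gerDl oppr_le0 mulr_ge0 ?(ltW k0) // Fp //.
    exact: le_trans xT.
  - by rewrite subrr.
  - move=> z /andP[z1 z2] _.
    set s := sq z in z1 z2 *.
    have s0 : 0 < s by exact: lt_trans z1.
    have s1 : 1 <= s by apply: le_trans S1 (ltW z1).
    have [] := F12E s s0; set t := s + 1; set p := t `^ _ => F1E F2E.
    have t0 : 0 < t by exact: addr_gt0.
    have p0 : 0 < p by exact: powR_gt0.
    have L2 : 2 <= ga * ln t by apply: lnS; exact: ltW.
    have Lt : ln t <= t by exact: ln_le_id.
    have pt : p * t = t `^ (- (ga + 1)) by rewrite -powRS //; congr (_ `^ _); ring.
    have kp : 0 < k * p by rewrite mulr_gt0.
    have L0 : 0 <= ln t by rewrite -(pmulr_rge0 _ ga0); exact: le_trans L2.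
    have L3 : 0 <= ga * (ga * ln t - 2) by rewrite mulr_ge0 ?(ltW ga0) // subr_ge0.
    rewrite F1E F2E; split.
    + rewrite mulrA mulr_ge0_le0 ?subr_le0 //; last by lra.
      by rewrite mulrA mulr_ge0 ?ltW // ltW.
    + have -> : 2 * (k * (p * t * (1 - ga * ln t))) +
         4 * s * (k * (p * (ga * (ga + 1) * ln t - (2 * ga + 1)))) =
         2 * (k * p) * ((2 * s - t) * (ga * (ga * ln t - 2) + (ga * ln t - 1)) +
           t * (ga * (ga * ln t - 2))) by ring.
      apply: mulr_ge0; first by rewrite mulr_ge0 // ltW.
      have i1 : 0 <= 2 * s - t by rewrite /t; lra.
      have i2 : 0 <= ga * (ga * ln t - 2) + (ga * ln t - 1) by lra.
      by apply: addr_ge0; apply: mulr_ge0 => //; exact: ltW.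
    + have H1 : absorption q (C / 2) * s `^ (- (ga + 1)) <= absorption q (w z / 2).
        apply: le_trans (absorption_power _ s1) _; first by rewrite divr_gt0.
        apply: absorption_le => //; first
          by rewrite mulr_ge0 ?powR_ge0 // divr_ge0 // ltW.
        by have := HC z s1; rewrite -/s => H; lra.
      apply: lt_le_trans H1.
      have -> : - 4 * lam * ((ga + 1) * (k * (p * t * (1 - ga * ln t))) +
           s * (k * (p * (ga * (ga + 1) * ln t - (2 * ga + 1))))) =
         4 * lam * (k * p) * (ga * t + ga * (ga + 1) * ln t - (2 * ga + 1))
           by rewrite /t; ring.
      have sp : 0 < s `^ (- (ga + 1)) by exact: powR_gt0.
      have ts : p * t <= s `^ (- (ga + 1)).
        by rewrite pt; apply: powR_le_antimono; rewrite ?addr_ge0 ?(ltW ga0) // lerDl.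
      apply: (@le_lt_trans _ _ (4 * lam * (k * (ga * (ga + 2))) * (p * t))).
        have -> : 4 * lam * (k * (ga * (ga + 2))) * (p * t) =
          4 * lam * (k * p) * (ga * (ga + 2) * t) by ring.
        apply: ler_wpM2l; first by rewrite !mulr_ge0 // ltW.
        have : ga * (ga + 1) * ln t <= ga * (ga + 1) * t.
          by apply: ler_wpM2l => //; rewrite mulr_ge0 ?addr_ge0 ?ltW // ltW.
        lra.
      apply: (@le_lt_trans _ _ (4 * lam * (k * (ga * (ga + 2))) * s `^ (- (ga + 1)))).
        by apply: ler_wpM2l => //; rewrite !mulr_ge0 // ltW.
      by rewrite ltr_pM2r.
  - by rewrite Sx xT.
apply/ler_addgt0Pr => r r0.
have [Tr Tr1 HT] := powlog_vanish ga0 (divr_gt0 r0 k0).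
pose T := Num.max Tr (sq x).
have TT : Tr <= T by rewrite le_max lexx.
have xT : sq x <= T by rewrite le_max lexx orbT.
have FT : k * F T <= r.
  have T1 : Tr <= T + 1 by apply: le_trans TT _; rewrite lerDl.
  by have := HT (T + 1) T1; rewrite ler_pdivlMr // -FE mulrC.
have := main T xT; lra.
Qed.

(** Far from [y] the logarithm beats [K]; on the remaining fixed ball [w] has a positive minimum,
    while [K T^-ga] tends to 0. *)
Lemma superfundamental_growth (K : R) : 0 <= K -> exists2 T1 : R, 1 <= T1 &
  forall T, T1 <= T -> forall x, sq x <= T -> K * T `^ (- ga) <= w x.
Proof.
move=> K0; have [wp _] := positive_lower_bound.
have [[k S] [/= k0 S1 HkS]] := log_lower_bound.
have kc : 0 < k * 2 `^ (- ga) by rewrite mulr_gt0 // powR_gt0.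
pose S' := Num.max S (expR (K / (k * 2 `^ (- ga)))).
have SS' : S <= S' by rewrite le_max lexx.
have S'1 : 1 <= S' by exact: le_trans SS'.
have S'0 : 0 < S' by exact: lt_le_trans S'1.
have far (T : R) x : S' <= sq x -> sq x <= T -> K * T `^ (- ga) <= w x.
  move=> Sx xT; have x0 := lt_le_trans S'0 Sx.
  have x1 : 1 <= sq x by exact: le_trans Sx.
  apply: le_trans (HkS x (le_trans SS' Sx)).
  apply: (@le_trans _ _ (K * sq x `^ (- ga))).
    by apply: ler_wpM2l => //; apply: powR_le_antimono => //; exact: ltW.
  have L : K <= k * 2 `^ (- ga) * ln (sq x + 1).
    rewrite mulrC -ler_pdivrMr // -[leLHS]expRK ler_ln ?posrE ?expR_gt0 ?addr_gt0 //.
    apply: (@le_trans _ _ S'); first by rewrite le_max lexx orbT.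
    by apply: le_trans Sx _; rewrite lerDl.
  have P : 2 `^ (- ga) * sq x `^ (- ga) <= (sq x + 1) `^ (- ga).
    rewrite -powRM ?dotv_ge0 //; apply: powR_le_antimono;
      [exact: ltW | exact: addr_gt0 |].
    by move: (sq x) x1 => t t1; lra.
  have ln0 : 0 <= ln (sq x + 1).
    by rewrite -(pmulr_rge0 _ kc); exact: le_trans L.
  apply: le_trans (ler_wpM2r (powR_ge0 _ _) L) _.
  have -> : k * 2 `^ (- ga) * ln (sq x + 1) * sq x `^ (- ga) =
    k * ln (sq x + 1) * (2 `^ (- ga) * sq x `^ (- ga)) by ring.
  have -> : k * ((sq x + 1) `^ (- ga) * ln (sq x + 1)) =
    k * ln (sq x + 1) * (sq x + 1) `^ (- ga) by ring.
  by apply: ler_wpM2l => //; exact: mulr_ge0 (ltW k0) ln0.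
have yD : 0 <= sq y <= S' by rewrite subrr dotv0 lexx ltW.
have [z /set_mem _ zmin] := EVT_min_rV (ex_intro _ y yD)
  (@compact_annulus 0 S' (ltW S'0)) (continuous_subspaceT cw).
have K1 : 0 < K + 1 by rewrite ltr_wpDl.
have [T0 T01 HT0] := powR_vanish ga0 (divr_gt0 (wp z) K1).
exists (Num.max T0 S'); first by rewrite le_max T01.
move=> T; rewrite ge_max => /andP[T0T S'T] x xT.
have [Sx|Sx] := leP S' (sq x); first exact: far.
apply: (@le_trans _ _ (w z)).
  have := HT0 T T0T; rewrite ler_pdivlMr // => H.
  apply: le_trans H; rewrite mulrC; apply: ler_wpM2l;
    [exact: powR_ge0 | by rewrite lerDl].
by apply: zmin; rewrite inE /= dotv_ge0 ltW.
Qed.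

(* With [m] the minimum over the ball of squared radius [T], testing with
   [2 m (1 - s/(4 T))] bounds [m^(q-1)] by a multiple of [1/T]. *)
Lemma upper_decay : exists c C : R, [/\ 0 < c, 0 <= C & forall T m : R, 0 < T ->
  0 < m ->
  (forall x, sq x <= T -> m <= w x) -> (exists2 x, sq x <= T & w x = m) ->
  (c * m) `^ (q - 1) <= C / T].
Proof.
have Lam0 : 0 < Lam by exact: lt_le_trans lamLam.
(* Contact may occur at [T < s <= 4 T], where [power_lower_bound] still gives
   [w >= (m / 2) 8^-ga = 2 c m]. *)
pose c := 8 `^ (- ga) / 4.
have c0 : 0 < c by rewrite divr_gt0 // powR_gt0.
exists c, (N%:R * Lam / c); split=> //.
  by apply: divr_ge0; [apply: mulr_ge0 => //; exact: ltW | exact: ltW].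
move=> T m T0 m0 Hm [z zT wz].
(* It vanishes at [s = 4 T] and is at least [3 m / 2] for [s <= T], so it exceeds [w] at [z] and
   contact is interior. *)
pose g (s : R) := 0 * s ^+ 2 + (- (m / (2 * T))) * s + 2 * m.
have Dg (s : R) : 0 <= s -> is_derive s 1 g (- (m / (2 * T))).
  by move=> _; have := is_derive_quadratic 0 (- (m / (2 * T))) (2 * m) s;
    rewrite mulr0 mul0r add0r.
have Dg1 (s : R) : 0 <= s -> is_derive s 1 (fun _ => - (m / (2 * T))) 0.
  by move=> _; exact: is_derive_cst.
have [Cphi Hphi] := @C2_radial R N g _ (fun _ => 0) y Dg Dg1 (fun s _ => cvg_cst _).
have gE (s : R) : g s = 2 * m - m * (s / (2 * T)) by rewrite /g; ring.
have T4 : 0 < 4 * T by rewrite mulr_gt0.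
have zD : 0 <= sq z <= 4 * T by rewrite dotv_ge0 /=; apply: le_trans zT _; lra.
have wgz : w z < g (sq z).
  rewrite wz gE; have h : sq z / (2 * T) <= 1 / 2
    by rewrite ler_pdivrMr ?mulr_gt0 //; lra.
  by have := ler_wpM2l (ltW m0) h; lra.
have Dint x : 0 <= sq x <= 4 * T -> w x < g (sq x) ->
  \forall x' \near x, 0 <= sq x' <= 4 * T.
  move=> /andP[_ xT] wx; have lt4 : sq x < 4 * T.
    rewrite lt_neqAle xT andbT; apply/negP => /eqP E.
    have := w0 x; rewrite leNgt => /negP; apply; apply: lt_le_trans wx _.
    by rewrite E gE; have -> : 4 * T / (2 * T) = 2 by [field; rewrite gt_eqF]; lra.
  near=> x'; rewrite dotv_ge0 /=; apply: ltW; near: x'; exact: near_dotv_lt.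
have [x [/andP[_ xT] wx]] := contact_point Cphi (@compact_annulus 0 _ (ltW T4)) zD
  wgz Dint.
rewrite Hphi mulr0 scale0r add0r => Hx.
have lowx : 4 * c * m / 2 <= w x.
  have c1 : 4 * c <= 1.
    have -> : 4 * c = 8 `^ (- ga) by rewrite /c; field.
    have := @powR_le_antimono R ga 1 8 (ltW ga0) ltr01; rewrite powR1; apply; lra.
  have [xT1|xT1] := leP (sq x) T.
    apply: le_trans (Hm x xT1); have : 4 * c * m <= 1 * m by apply: ler_wpM2r => //;
      exact: ltW.
    lra.
  have := power_lower_bound T0 (ltW m0) (fun x' E => Hm x' (eq_ind_r (fun t =>
    t <= T) (lexx T) E)) (ltW xT1).
  apply: le_trans.
  have x0 : 0 < sq x by exact: lt_trans xT1.
  have : (8 * T) `^ (- ga) <= (2 * sq x) `^ (- ga).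
    by apply: powR_le_antimono; [exact: ltW | exact: mulr_gt0 | lra].
  rewrite powRM ?(ltW T0) // => H.
  have E : T `^ ga * T `^ (- ga) = 1 by rewrite -gt0_powRD // subrr powRr0.
  have -> : 4 * c * m / 2 = m / 2 * T `^ ga * (8 `^ (- ga) * T `^ (- ga)).
    transitivity (m / 2 * 8 `^ (- ga) * (T `^ ga * T `^ (- ga))); last by ring.
    by rewrite E /c; field.
  by apply: ler_wpM2l => //; rewrite mulr_ge0 ?powR_ge0 // divr_ge0 // ltW.
have cm0 : 0 <= c * m by apply: mulr_ge0; exact: ltW.
have H1 : absorption q (c * m) <= N%:R * Lam * m / T.
  apply: (@le_trans _ _ (absorption q (w x / 2)));
    first by apply: absorption_le => //; lra.
  apply: le_trans Hx _; apply: pucci_le => // A eA.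
  have /andP[_ tA] := elliptic_trace eA.
  rewrite mul_mx_scalar mxtraceZ.
  have -> : - (2 * - (m / (2 * T)) * \tr A) = m / T * \tr A by field; rewrite gt_eqF.
  have -> : N%:R * Lam * m / T = m / T * (N%:R * Lam) by ring.
  by apply: ler_wpM2l => //; rewrite divr_ge0 // ltW.
move: H1; rewrite absorption_ge0E // => H1.
have cmp : 0 < c * m by rewrite mulr_gt0.
rewrite -(ler_pM2r cmp); apply: le_trans H1 _.
by rewrite le_eqVlt; apply/orP; left; apply/eqP; field; rewrite !gt_eqF.
Unshelve. all: by end_near. Qed.

Lemma no_positive_supersolution : False.
Proof.
have [wp _] := positive_lower_bound.
have [c [C [c0 C0 HcC]]] := upper_decay.
have est (K : R) : 0 <= K -> exists2 T1 : R, 1 <= T1 & forall T, T1 <= T ->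
    (c * K) `^ (q - 1) * T `^ (- (ga * (q - 1))) <= C / T.
  move=> K0; have [T1 T11 HT1] := superfundamental_growth K0.
  exists T1 => // T TT; have T0 : 0 < T by apply: lt_le_trans TT;
    exact: lt_le_trans T11.
  have yD : 0 <= sq y <= T by rewrite subrr dotv0 lexx ltW.
  have [z /set_mem /andP[_ zT] zmin] := EVT_min_rV (ex_intro _ y yD)
    (@compact_annulus 0 T (ltW T0)) (continuous_subspaceT cw).
  have Hz x : sq x <= T -> w z <= w x by move=> xT; apply: zmin;
    rewrite inE /= dotv_ge0.
  apply: le_trans (HcC T (w z) T0 (wp z) Hz (ex_intro2 _ _ z zT erefl)).
  have -> : - (ga * (q - 1)) = - ga * (q - 1) by ring.
  rewrite powRrM -powRM ?powR_ge0 ?mulr_ge0 ?(ltW c0) //.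
  apply: ge0_ler_powR; rewrite ?subr_ge0 ?nnegrE ?mulr_ge0 ?powR_ge0 ?(ltW c0) ?(ltW
    (wp z)) //.
  by rewrite -mulrA; apply: ler_wpM2l; [exact: ltW | exact: HT1].
have [q2|q2] := eqVneq q 1.
  (* For [q = 1] both powers have exponent 0 and equal 1, even at base 0, so the estimate reads
     [1 <= C / T]. *)
  have [T1 T11 H] := est 0 (lexx 0).
  have T0 : 0 < T1 + C by apply: ltr_wpDr => //; exact: lt_le_trans T11.
  have := H (T1 + C) _; rewrite lerDl => /(_ C0).
  rewrite q2 subrr !mulr0 oppr0 !powRr0 mulr1 ler_pdivlMr // mul1r.
  by rewrite leNgt ltrDr (lt_le_trans _ T11).
have qp : 0 < q - 1 by rewrite subr_gt0 lt_neqAle eq_sym q2.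
(* With [K = X / c] the left side is [(C + 1) T^-(ga (q - 1))], at least [(C + 1) / T]. *)
pose X := (C + 1) `^ (q - 1)^-1.
have C1 : 0 < C + 1 by rewrite ltr_wpDl.
have X0 : 0 <= X / c by rewrite divr_ge0 ?powR_ge0 // ltW.
have [T1 T11 H] := est _ X0.
have T0 : 0 < T1 by exact: lt_le_trans T11.
have := H T1 (lexx _).
rewrite [c * _]mulrC divfK ?gt_eqF // /X -powRrM mulVf ?gt_eqF // powRr1 ?(ltW C1) //.
rewrite leNgt => /negP; apply.
apply: (@lt_le_trans _ _ ((C + 1) / T1)); first by rewrite ltr_pM2r ?invr_gt0 // ltrDl.
apply: ler_wpM2l; first exact: ltW.
rewrite -powR_inv1 ?(ltW T0) //; apply: ler_powR => //.
by rewrite lerN2 mulrC.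
Qed.

End Liouville.

Theorem theorem5p1 (R : realType) (N : nat) (lam Lam q : R)
  (u v : 'rV[R]_N -> R) :
  (1 <= N)%N -> 0 < lam -> lam <= Lam ->
  let beta := Lam / lam * (N.-1)%:R + 1 in
  2 < beta -> 1 <= q -> q <= beta / (beta - 2) ->
  visc_sub lam Lam q u -> visc_super lam Lam q v ->
  (forall x, u x <= v x) ->
  forall x, u x = v x.
Proof.
move=> N1 lam0 lamLam beta beta2 q1 qbeta usub vsuper uv y.
have wy : ~ 0 < v y - u y.
  move=> wy.
  have lamn0 : lam != 0 by rewrite gt_eqF.
  have ga0 : 0 < (beta - 2) / 2 by rewrite divr_gt0 ?subr_gt0.
  have LamN : Lam * (N.-1)%:R = lam * (2 * ((beta - 2) / 2) + 1).
    by rewrite /beta; field.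
  (* This is [q (beta - 2) <= beta] rearranged. *)
  have qga : (q - 1) * ((beta - 2) / 2) <= 1.
    by move: qbeta; rewrite ler_pdivlMr ?subr_gt0 // => qb; lra.
  apply: (no_positive_supersolution lam0 lamLam N1 ga0 LamN q1 qga
    (w := fun x => v x - u x) (y := y)) => //.
  - by move=> x; exact: (cvgB (vsuper.1 x) (usub.1 x)).
  - by move=> x; rewrite subr_ge0.
  - move=> phi x0 Cphi Hmin; apply: le_trans (absorption_sub q1 (uv x0)) _.
    exact: difference_supersolution Hmin.
by apply/eqP; rewrite eq_le uv /= -subr_le0 leNgt; apply/negP.
Qed.
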